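(* Let $n\ge 1$ and let $\Lambda$ be a lattice of full rank in $\mathbb{R}^n$. Assume that $B \ge 8 n^{n/2}\,\nu(\Lambda)$ and $B_1 \ge 8 n^2 (n+1) B$. Suppose $n$ vectors are selected uniformly at random from $\Lambda\cap[0,B)^n$ and $n+1$ vectors are selected uniformly at random from $\Lambda\cap[0,B_1)^n$, all $2n+1$ vectors being sampled independently. Then the probability that these $2n+1$ vectors generate $\Lambda$ (as an abelian group) is at least \[ \alpha_n := \Biggl( \prod_{i=2}^{n+1} \zeta(i)^{-1} - \tfrac14 \Biggr)\cdot \prod_{k=0}^{n-1}\biggl(1 - n^{k/2}\,\frac{(4n^{n/2}+1)^k}{(4n^{n/2}-1)^n}\biggr) \ \ge\ 0.092. \]
   Context: A lattice of full rank in $\mathbb{R}^n$ is a discrete subgroup of $\mathbb{R}^n$ spanning $\mathbb{R}^n$. The covering radius $\nu(\Lambda)$ is $\sup_{x\in\mathbb{R}^n}\min_{\lambda\in\Lambda}\|x-\lambda\|_2$. $\zeta$ denotes the Riemann zeta function. Sampling ''uniformly at random'' from a finite set means with respect to the uniform distribution on that set. *)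

(* Defs.v *)
From HB Require Import structures.
From mathcomp Require Import all_boot all_order all_algebra finmap.
From mathcomp Require Import all_classical all_reals all_analysis.
Set Implicit Arguments. Unset Strict Implicit. Unset Printing Implicit Defensive.
Import Order.TTheory GRing.Theory Num.Theory numFieldNormedType.Exports.
Local Open Scope classical_set_scope.
Local Open Scope ring_scope.

Section Defs.
Variables (R : realType) (n : nat).

Definition norm2 (x : 'rV[R]_n) : R := Num.sqrt (\sum_(i < n) x ord0 i ^+ 2).

Definition is_full_lattice (L : set 'rV[R]_n) : Prop :=
  [/\ L 0,
      (forall x y, L x -> L y -> L (x - y)),
      (forall x, L x -> exists2 e : R, 0 < e &
          forall y, L y -> norm2 (y - x) < e -> y = x) &
      (forall y : 'rV[R]_n, exists m (c : 'I_m -> R) (v : 'I_m -> 'rV[R]_n),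
          (forall i, L (v i)) /\ y = \sum_(i < m) c i *: v i)].

Definition covering_radius (L : set 'rV[R]_n) : R :=
  sup [set d | exists x : 'rV[R]_n, d = inf [set norm2 (x - l) | l in L]].

Definition box (B : R) : set 'rV[R]_n :=
  [set x | forall i, 0 <= x ord0 i < B].

Definition gen_group p q (v : 'I_p -> 'rV[R]_n) (w : 'I_q -> 'rV[R]_n)
  : set 'rV[R]_n :=
  [set x | exists (a : 'I_p -> int) (b : 'I_q -> int),
      x = \sum_(i < p) v i *~ a i + \sum_(j < q) w j *~ b j].

Definition gen_prob (L : set 'rV[R]_n) (B B1 : R) : R :=
  let S := fset_set (L `&` box B) in
  let S1 := fset_set (L `&` box B1) in
  (#|[set fg : {ffun 'I_n -> S} * {ffun 'I_n.+1 -> S1} |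
       `[< gen_group (fun i => val (fg.1 i)) (fun j => val (fg.2 j)) = L >] ]|%:R
   / #|{: {ffun 'I_n -> S} * {ffun 'I_n.+1 -> S1}}|%:R).

End Defs.

Definition zeta (R : realType) (s : nat) : R :=
  limn (series (fun k : nat => (((k.+1)%:R : R) ^+ s)^-1)).

Definition alpha (R : realType) (n : nat) : R :=
  let s := Num.sqrt (n%:R : R) in
  ((\prod_(2 <= i < n.+2) (zeta R i)^-1) - 4^-1) *
  \prod_(k < n) (1 - s ^+ k * (4 * s ^+ n + 1) ^+ k / (4 * s ^+ n - 1) ^+ n).

(* Main.v *)
(** Let [s = sqrt n], [nu] the covering radius, [W] the first window and [W1] the
    second.

    Counting.  If a finite set [U] has translates by approximate grid points that
    fit disjointly into large boxes, and a finite set [V] has translates that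
    cover everything in the same large boxes, then counting the points of the
    lattice in boxes of side tending to infinity compares [|U|] with [|V|]
    exactly as volumes would; no measure is needed.

    Independence.  Let [H] be a subspace of dimension [k < n].  Choosing [k]
    coordinates on which a basis of [H] has its largest minor, [H] is the graph
    of a linear map with entries in [-1, 1], so a sheared box with [k] sides
    [B + 2 nu] and [n - k] sides [2 nu sqrt (k + 1)] contains the
    [nu]-neighbourhood of the points of [H] in [W].  Compared with the points of
    the lattice in [W], this bounds the probability of falling in [H], hence
    that [n] vectors are dependent.

    Generation.  Let the first [n] vectors span the sublattice [M].  The cosets
    of [M] have almost equally many points in [W1], so the other [n + 1] vectors
    are nearly uniform in the finite group [L / M], the total loss being a
    factor [3/4].  This group has a filtration with [n] cyclic quotients.  If
    [G / K] is cyclic of order [d] and a tuple of [m] elements generates [G / K],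
    a unimodular change of the tuple puts all but its first entry in [K], and
    then these [m - 1] entries need only generate [K]. So [n + 1] uniform
    elements generate with probability at least the product for [2 <= i <= n + 1]
    of the probabilities that [i] elements generate a cyclic group; each of these
    is a partial Euler product of [1 / zeta i]. *)

Require Import Defs.
From HB Require Import structures.
From mathcomp Require Import all_boot all_order all_algebra finmap.
From mathcomp Require Import all_classical all_reals all_analysis.
From mathcomp Require Import zify ring lra.
Import Order.TTheory GRing.Theory Num.Theory numFieldNormedType.Exports.
Set Implicit Arguments.
Unset Strict Implicit.
Unset Printing Implicit Defensive.
Local Open Scope classical_set_scope.
Local Open Scope ring_scope.

(** * Generating tuples of finite abelian groups *)

Section IntegerSpans.
Variable V : zmodType.

Definition zspan m (t : 'I_m -> V) : set V :=
  [set x | exists c : 'I_m -> int, x = \sum_i t i *~ c i].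

(** A tuple acts as a row vector with entries in a [Z]-module; multiplying by an invertible matrix
    does not change its span. *)
Definition mulzmx m p (t : 'I_m -> V) (M : 'M[int]_(m, p)) (j : 'I_p) : V :=
  \sum_i t i *~ M i j.

Lemma mem_zspan m (t : 'I_m -> V) i : zspan t (t i).
Proof.
exists (fun j => (j == i)%:Z); rewrite (bigD1 i) //= eqxx mulr1z big1 ?addr0 //.
by move=> j /negPf ->; rewrite mulr0z.
Qed.

Lemma zspanB m (t : 'I_m -> V) x y : zspan t x -> zspan t y -> zspan t (x - y).
Proof.
move=> [c ->] [c' ->]; exists (fun i => c i - c' i).
by rewrite -sumrB; apply: eq_bigr => i _; rewrite mulrzBr.
Qed.

Lemma zspanMz m (t : 'I_m -> V) x (k : int) : zspan t x -> zspan t (x *~ k).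
Proof.
move=> [c ->]; exists (fun i => c i * k).
by rewrite mulrz_suml; apply: eq_bigr => i _; rewrite mulrzA.
Qed.

Lemma zspanD m (t : 'I_m -> V) x y : zspan t x -> zspan t y -> zspan t (x + y).
Proof.
by move=> hx hy; rewrite -[y]opprK -[- y]mulrN1z; apply/zspanB/zspanMz.
Qed.

Lemma zspan_sum m (t : 'I_m -> V) p (x : 'I_p -> V) :
  (forall i, zspan t (x i)) -> zspan t (\sum_i x i).
Proof.
move=> hx; elim/big_ind: _ => // [|y z]; last exact: zspanD.
by exists (fun=> 0); rewrite big1.
Qed.

Lemma zspan_sub m (t : 'I_m -> V) p (t' : 'I_p -> V) x :
  (forall i, zspan t' (t i)) -> zspan t x -> zspan t' x.
Proof. by move=> ht [c ->]; apply: zspan_sum => i; apply: zspanMz. Qed.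

Lemma zspan_mulzmx m p (t : 'I_m -> V) (M : 'M[int]_(m, p)) j :
  zspan t (mulzmx t M j).
Proof. by exists (fun i => M i j). Qed.

Lemma mulzmxM m p q (t : 'I_m -> V) (M : 'M[int]_(m, p)) (M' : 'M[int]_(p, q)) j :
  mulzmx (mulzmx t M) M' j = mulzmx t (M *m M') j.
Proof.
rewrite /mulzmx; under eq_bigr do rewrite mulrz_suml.
rewrite exchange_big /=; apply: eq_bigr => i _.
by rewrite mxE mulrz_sumr; apply: eq_bigr => k _; rewrite mulrzA.
Qed.

Lemma mulzmx1 m (t : 'I_m -> V) j : mulzmx t 1%:M j = t j.
Proof.
rewrite /mulzmx (bigD1 j) //= mxE eqxx mulr1z big1 ?addr0 // => i /negPf ij.
by rewrite mxE ij mulr0z.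
Qed.

Lemma eq_mulzmx m p (t t' : 'I_m -> V) (M : 'M[int]_(m, p)) j :
  t =1 t' -> mulzmx t M j = mulzmx t' M j.
Proof. by move=> e; apply: eq_bigr => i _; rewrite e. Qed.

Lemma mulzmxK m (t : 'I_m -> V) (M : 'M[int]_m) j :
  M \in unitmx -> mulzmx (mulzmx t M) (invmx M) j = t j.
Proof. by move=> uM; rewrite mulzmxM mulmxV // mulzmx1. Qed.

End IntegerSpans.

(** In the Smith form of a one-row matrix the left factor is a scalar and the diagonal part has one
    entry that may be nonzero, so only the first row of the right factor remains. *)
Lemma row_unimodular m (a : 'I_m.+1 -> int) :
  exists e (M : 'M[int]_m.+1), M \in unitmx /\ forall j, a j = e * M ord0 j.
Proof.
have [L _ [M uM [d _ eM]]] := int_Smith_normal_form (\row_j a j).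
exists (L ord0 ord0 * d`_0), M; split=> // j.
have := congr1 (fun A : 'M[int]_(1, m.+1) => A ord0 j) eM; rewrite /= mxE => ->.
rewrite mxE (bigD1 ord0) //= big1 ?addr0 => [|i i0]; last first.
  rewrite mxE big_ord1 mxE; case: i i0 => [[|i] hi] //= _.
  by rewrite mulr0n mulr0 mul0r.
by rewrite mxE big_ord1 mxE /= mulr1n.
Qed.

Lemma ltn_absz_modz (c : int) (d : nat) : (0 < d)%N -> (`|(c %% d)%Z| < d)%N.
Proof.
move=> d_gt0; have dz : 0 < d%:Z by [].
have := ltz_pmod c dz; have := modz_ge0 c (lt0r_neq0 dz); lia.
Qed.

Lemma dvdz_ltn_eq (d a b : nat) :
  (a < d)%N -> (b < d)%N -> (d %| a%:Z - b%:Z)%Z -> a = b.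
Proof.
move=> ad bd; rewrite -eqz_mod_dvd !modz_nat !modn_small // => /eqP[].
exact.
Qed.

(** With residues represented below [d], these are the tuples that generate [Z/d]. *)
Definition coprime_tuples m d : {set {ffun 'I_m -> 'I_d}} :=
  [set a : {ffun 'I_m -> 'I_d} | coprime (\big[gcdn/0%N]_i a i) d].

Section FiniteGroups.
Variable V : finZmodType.
Implicit Types G K : {set V}.

Definition zsubgroup G := 0 \in G /\ forall x y, x \in G -> y \in G -> x - y \in G.

Definition generators m G : {set {ffun 'I_m -> V}} :=
  [set t : {ffun 'I_m -> V} |
    `[< (forall i, t i \in G) /\ forall x, x \in G -> zspan t x >]].

(** The last two premises make [y] a generator of [G / K], of order [d]. Order 1 is allowed, so the
    length of a chain can be prescribed. *)
Inductive cyclic_chain : nat -> {set V} -> Prop :=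
| cyclic_chain0 : cyclic_chain 0 [set 0]
| cyclic_chainS k K G y d : cyclic_chain k K -> zsubgroup K -> zsubgroup G ->
    K \subset G -> y \in G -> (0 < d)%N ->
    (forall x, x \in G -> exists c : int, x - y *~ c \in K) ->
    (forall c : int, (y *~ c \in K) = (d %| c)%Z) -> cyclic_chain k.+1 G.

Lemma zsubgroupN G x : zsubgroup G -> x \in G -> - x \in G.
Proof. by move=> [G0 GB] Gx; rewrite -sub0r GB. Qed.

Lemma zsubgroupD G x y : zsubgroup G -> x \in G -> y \in G -> x + y \in G.
Proof. by move=> sG Gx Gy; rewrite -[y]opprK sG.2 ?zsubgroupN. Qed.

Lemma zsubgroupMz G x (c : int) : zsubgroup G -> x \in G -> x *~ c \in G.
Proof.
move=> sG Gx; have Gn n : x *+ n \in G.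
  by elim: n => [|n IHn]; [exact: sG.1 | rewrite mulrS zsubgroupD].
by case: c => n; rewrite ?NegzE ?mulrNz; [|apply: zsubgroupN => //]; apply: Gn.
Qed.

Lemma zsubgroup_sum G p (x : 'I_p -> V) (P : pred 'I_p) : zsubgroup G ->
  (forall i, P i -> x i \in G) -> \sum_(i | P i) x i \in G.
Proof.
move=> sG hx; elim/big_ind: _ => //; first exact: sG.1.
by move=> ? ?; apply: zsubgroupD.
Qed.

Section CyclicQuotient.
Variables (m : nat) (K G : {set V}) (y : V) (d : nat).
Hypotheses (sK : zsubgroup K) (sG : zsubgroup G) (sKG : K \subset G).
Hypotheses (Gy : y \in G) (d_gt0 : (0 < d)%N).
Hypothesis quoG : forall x, x \in G -> exists c : int, x - y *~ c \in K.
Hypothesis ordy : forall c : int, (y *~ c \in K) = (d %| c)%Z.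

Lemma card_cyclic_quotient : (#|G| <= d * #|K|)%N.
Proof.
pose f (x : 'I_d * V) := y *~ (x.1)%:Z + x.2.
have sGf : G \subset f @: finset.setX [set: 'I_d]%SET K.
  apply/fintype.subsetP => x /quoG[c Kc].
  have lt_cd := ltn_absz_modz c d_gt0.
  apply/imsetP; exists (Ordinal lt_cd, x - y *~ (c %% d)%Z).
    rewrite !inE /=.
    have -> : x - y *~ (c %% d)%Z = (x - y *~ c) + y *~ ((c %/ d)%Z * d).
      have ec : y *~ c = y *~ ((c %/ d)%Z * d) + y *~ (c %% d)%Z.
        by rewrite -mulrzDr -divz_eq.
      by rewrite ec opprD [- _ + _]addrC addrA subrK.
    by rewrite zsubgroupD // ordy dvdz_mull.
  rewrite /f /= gez0_abs ?modz_ge0 //; first by rewrite addrC subrK.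
  by rewrite lt0n_neq0.
apply: leq_trans (subset_leq_card sGf) (leq_trans (leq_imset_card _ _) _).
by rewrite cardsX cardsT card_ord.
Qed.

Let base (e : int) (k : V) (s : {ffun 'I_m -> V}) (i : 'I_m.+1) : V :=
  if fintype.unlift ord0 i is Some j then s j else y *~ e + k.

Let base_inj e k s k' s' : base e k s =1 base e k' s' -> k = k' /\ s = s'.
Proof.
move=> eb; split; first by move: (eb ord0); rewrite /base unlift_none => /addrI.
by apply/ffunP => i; move: (eb (lift ord0 i)); rewrite /base liftK.
Qed.

(** Modulo [K] only the first entry of the base tuple survives, hence only the first row of [M]
    matters. *)
Let base_mod e k (s : {ffun 'I_m -> V}) (M : 'M[int]_m.+1) j : k \in K -> (forall i, s i \in K) ->
  mulzmx (base e k s) M j - y *~ (e * M ord0 j) \in K.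
Proof.
move=> Kk Ks; rewrite /mulzmx (bigD1 ord0) //= {1}/base unlift_none mulrzDl.
have cancel (p q r : V) : p + q + r - p = q + r by rewrite addrC !addrA addNr add0r.
rewrite [y *~ (_ * _)]mulrzA cancel.
apply: zsubgroupD => //; first exact: zsubgroupMz.
apply: zsubgroup_sum => // i; case: (unliftP ord0 i) => [i' ->|->] // _.
by rewrite /base liftK; apply: zsubgroupMz.
Qed.

(** Bezout: if [u * e + v * d = 1], then [y] is [u] times [y *~ e] plus a multiple of [y *~ d],
    which lies in [K] and so in the span of [s]. *)
Let zspan_base e k (s : {ffun 'I_m -> V}) : coprimez e d -> k \in K -> s \in generators m K ->
  forall x, x \in G -> zspan (base e k s) x.
Proof.
move=> /coprimezP[[u v] /= uv1] Kk; rewrite inE => /asboolP[Ks genK].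
have spK x : x \in K -> zspan (base e k s) x.
  move=> /genK; apply: zspan_sub => i.
  have -> : s i = base e k s (lift ord0 i) by rewrite /base liftK.
  exact: mem_zspan.
have spy : zspan (base e k s) y.
  rewrite -[y]mulr1z -uv1 mulrzDr; apply: zspanD.
    rewrite mulrC mulrzA; apply: zspanMz.
    have -> : y *~ e = base e k s ord0 - k by rewrite /base unlift_none addrK.
    by apply: zspanB; [exact: mem_zspan | exact: spK].
  by apply: spK; rewrite ordy dvdz_mull.
move=> x /quoG[c Kc]; rewrite -[x](subrK (y *~ c)); apply: zspanD; first exact: spK.
exact: zspanMz.
Qed.

(** A coprime tuple [a] of residues, an element [k] of [K] and a generating tuple [s] of [K] are
    sent to [base e k s] times a unimodular matrix with first row [a / e]. The result generates [G],
    and this map is injective. *)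
Lemma card_generators_step :
  (#|coprime_tuples m.+1 d| * #|K| * #|generators m K| <=
   #|generators m.+1 G|)%N.
Proof.
have hU (a : {ffun 'I_m.+1 -> 'I_d}) : exists eM : int * 'M[int]_m.+1,
    eM.2 \in unitmx /\ forall j, (a j)%:Z = eM.1 * eM.2 ord0 j.
  by have [e [M []]] := row_unimodular (fun j => (a j)%:Z); exists (e, M).
have [U hUP] := choice hU.
pose F (x : {ffun 'I_m.+1 -> 'I_d} * V * {ffun 'I_m -> V}) : {ffun 'I_m.+1 -> V} :=
  [ffun j => mulzmx (base (U x.1.1).1 x.1.2 x.2) (U x.1.1).2 j].
pose D := finset.setX (finset.setX (coprime_tuples m.+1 d) K) (generators m K).
have <- : #|F @: D| = (#|coprime_tuples m.+1 d| * #|K| * #|generators m K|)%N.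
  rewrite card_in_imset ?cardsX // => -[[a k] s] [[a' k'] s'].
  rewrite !inE /= => /andP[/andP[_ Kk] /asboolP[Ks _]].
  move=> /andP[/andP[_ Kk'] /asboolP[Ks' _]] /ffunP eF.
  have {}eF j : mulzmx (base (U a).1 k s) (U a).2 j =
                mulzmx (base (U a').1 k' s') (U a').2 j.
    by move: (eF j); rewrite !ffunE.
  (* The class of entry [j] modulo [K] is [y *~ a j], which determines [a j] below the order [d].
     The same [a] gives the same matrix, which is then inverted. *)
  have eaa' : a = a'.
    apply/ffunP => j; apply/val_inj => /=.
    have h1 := base_mod (U a).1 (U a).2 j Kk Ks.
    have h2 := base_mod (U a').1 (U a').2 j Kk' Ks'.
    have := sK.2 _ _ h2 h1; rewrite eF -(hUP a).2 -(hUP a').2.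
    have cancel (p q r : V) : p - q - (p - r) = r - q.
      by rewrite opprB addrC addrA subrK.
    rewrite cancel -mulrzBr ordy.
    by apply: dvdz_ltn_eq; exact: ltn_ord.
  rewrite -eaa' in eF *.
  have /base_inj[-> ->] // : base (U a).1 k s =1 base (U a).1 k' s'.
  move=> i; rewrite -(mulzmxK _ i (hUP a).1) -[RHS](mulzmxK _ i (hUP a).1).
  exact: eq_mulzmx.
apply/subset_leq_card/fintype.subsetP => x0 /imsetP[[[a k] s] Dx ->{x0}].
have [cop_a Kk genK] : [/\ a \in coprime_tuples m.+1 d, k \in K & s \in generators m K].
  by move: Dx; rewrite 2!finset.in_setX /= => /andP[/andP[]].
have [uM aM] := hUP a.
(* [e] divides every entry of [a], so a common divisor of [e] and [d] divides the gcd of the tuple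
   as well. *)
have cop_e : coprimez (U a).1 d.
  have : (gcdn `|(U a).1| d %| gcdn (\big[gcdn/0%N]_i a i) d)%N.
    rewrite dvdn_gcd dvdn_gcdr andbT; apply/dvdn_biggcdP => j _.
    apply: dvdn_trans (dvdn_gcdl _ _) _.
    have -> : (a j : nat) = `|(a j)%:Z|%N by [].
    by rewrite aM abszM dvdn_mulr.
  by move: cop_a; rewrite inE /coprime => /eqP ->; rewrite dvdn1.
have spG := zspan_base cop_e Kk genK.
rewrite inE; apply/asboolP; split=> [j|x /spG].
  rewrite ffunE; apply: zsubgroup_sum => // i _; apply: zsubgroupMz => //.
  move: genK; rewrite inE => /asboolP[Ks _].
  rewrite /base; case: fintype.unlift => [i'|]; first exact: (fintype.subsetP sKG).
  by apply: zsubgroupD => //; [exact: zsubgroupMz | exact: (fintype.subsetP sKG)].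
apply: zspan_sub => i; rewrite -(mulzmxK _ i uM).
rewrite (@eq_mulzmx _ _ _ _ (F (a, k, s)) _ i); first exact: zspan_mulzmx.
by move=> j; rewrite ffunE.
Qed.

End CyclicQuotient.

(** Induction along the chain. [z m] bounds from below, uniformly in [d], the probability that [m]
    residues generate [Z/d]; each cyclic quotient uses up one entry of the tuple, and so contributes
    one factor. *)
Lemma card_generators_ge (R : realType) (z : nat -> R) k G :
  (forall i, 0 <= z i) ->
  (forall m d, (2 <= m)%N -> (0 < d)%N -> d%:R ^+ m * z m <= #|coprime_tuples m d|%:R) ->
  cyclic_chain k G ->
  #|G|%:R ^+ k.+1 * \prod_(2 <= i < k.+2) z i <= #|generators k.+1 G|%:R :> R.
Proof.
move=> z_ge0 hz; elim=> {k G} [|k K G y d _ IHk sK sG sKG Gy d_gt0 quoG ordy].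
  rewrite cards1 expr1n big_geq // mul1r ler1n card_gt0; apply/set0Pn.
  exists [ffun=> 0]; rewrite inE; apply/asboolP.
  split=> [i|x /set1P ->]; first by rewrite ffunE inE.
  by exists (fun=> 0); rewrite big1 // => i _; rewrite mulr0z.
have := card_generators_step k.+1 sK sG sKG Gy quoG ordy.
rewrite -(ler_nat R) !natrM; apply: le_trans.
have hG : #|G|%:R <= d%:R * #|K|%:R :> R.
  by rewrite -natrM ler_nat (card_cyclic_quotient sK d_gt0 quoG ordy).
rewrite (@big_nat_recr _ _ _ k.+2) //= mulrA.
have pz : 0 <= \prod_(2 <= i < k.+2) z i by apply: prodr_ge0.
apply: (@le_trans _ _ ((d%:R * #|K|%:R) ^+ k.+2 * \prod_(2 <= i < k.+2) z i * z k.+2)).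
  by do 2![apply: ler_wpM2r => //]; apply: lerXn2r; rewrite ?nnegrE // mulr_ge0.
have -> : (d%:R * #|K|%:R) ^+ k.+2 * \prod_(2 <= i < k.+2) z i * z k.+2 =
    (d%:R ^+ k.+2 * z k.+2) * #|K|%:R *
    (#|K|%:R ^+ k.+1 * \prod_(2 <= i < k.+2) z i) :> R.
  by rewrite exprMn [#|K|%:R ^+ k.+2]exprS; ring.
apply: ler_pM => //.
- by do 2![apply: mulr_ge0 => //]; rewrite exprn_ge0.
- by apply: mulr_ge0 => //; rewrite exprn_ge0.
- by apply: ler_wpM2r => //; exact: hz.
Qed.

End FiniteGroups.

(** * Coprime tuples and the zeta function *)

Section Sieve.
Variable (R : realType).

Definition sieved_tuples m d (ps : seq nat) : {set {ffun 'I_m -> 'I_d}} :=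
  [set t : {ffun 'I_m -> 'I_d} |
    all (fun p => [exists i, ~~ (p %| t i)%N]) ps].

(** Induction on the primes. The tuples lost to [p] are [p] times the tuples below [d / p], and
    multiplication by [p] does not affect the sieve by the other primes. *)
Lemma card_sieved_tuples m (ps : seq nat) d : all prime ps -> uniq ps ->
  (0 < d)%N -> (\prod_(p <- ps) p %| d)%N ->
  #|sieved_tuples m d ps|%:R = d%:R ^+ m * \prod_(p <- ps) (1 - (p%:R ^+ m)^-1) :> R.
Proof.
elim: ps d => [|p ps IHps] d.
  move=> _ _ _ _; rewrite big_nil mulr1 -natrX; congr _%:R.
  rewrite -[in RHS](card_ord d) -[in RHS](card_ord m) -card_ffun -cardsT.
  by apply: eq_card => t; rewrite !inE.
case/andP=> p_pr ps_pr /andP[p_ps ups] d_gt0; rewrite !big_cons => dvd_d.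
have p_gt0 := prime_gt0 p_pr.
have /dvdnP[d' def_d] : (p %| d)%N by apply: dvdn_trans dvd_d; apply: dvdn_mulr.
rewrite mulnC in def_d.
have d'_gt0 : (0 < d')%N by move: d_gt0; rewrite def_d muln_gt0 => /andP[].
have dvd_d' : (\prod_(p <- ps) p %| d')%N by rewrite -(dvdn_pmul2l p_gt0) -def_d.
have dvd_d2 : (\prod_(p <- ps) p %| d)%N by rewrite def_d dvdn_mull.
have mulP (x : 'I_d') : (p * x < d)%N by rewrite def_d ltn_pmul2l.
pose f (t : {ffun 'I_m -> 'I_d'}) : {ffun 'I_m -> 'I_d} := [ffun i => Ordinal (mulP (t i))].
have f_inj : injective f.
  move=> t t' /ffunP e; apply/ffunP => i; apply/val_inj => /=.
  have /(congr1 val) := e i; rewrite !ffunE /= => /eqP.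
  by rewrite eqn_pmul2l // => /eqP.
have -> : sieved_tuples m d (p :: ps) =
    sieved_tuples m d ps :\: (f @: sieved_tuples m d' ps).
  apply/finset.setP => t; rewrite !inE /=; case: (boolP (all _ ps)) => ht; last by rewrite !andbF.
  rewrite !andbT; apply/idP/idP.
    case/existsP => i pti; apply/imsetP => -[t' _ et]; move: pti.
    by rewrite et ffunE /= dvdn_mulr.
  apply: contraNT; rewrite negb_exists => /forallP pt.
  have {}pt i : (p %| t i)%N by have := pt i; rewrite negbK.
  have divP (i : 'I_m) : (t i %/ p < d')%N.
    by rewrite ltn_divLR // mulnC -def_d.
  apply/imsetP; exists [ffun i => Ordinal (divP i)].
    rewrite inE; apply/allP => q qps; have /existsP[i qti] := allP ht q qps.
    apply/existsP; exists i; rewrite ffunE /=; apply: contra qti => qti.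
    by rewrite -(divnK (pt i)) dvdn_mulr.
  by apply/ffunP => i; apply/val_inj; rewrite !ffunE /= mulnC divnK.
have sub_f : f @: sieved_tuples m d' ps \subset sieved_tuples m d ps.
  apply/fintype.subsetP => _ /imsetP[t + ->]; rewrite !inE => /allP ht.
  apply/allP => q qps; have /existsP[i qti] := ht q qps.
  apply/existsP; exists i; rewrite ffunE /= Gauss_dvdr //.
  have q_pr : prime q := allP ps_pr q qps.
  rewrite prime_coprime // dvdn_prime2 //.
  by apply: contraNneq p_ps => e; move: qps; rewrite e.
rewrite finset.cardsD (finset.setIidPr sub_f) natrB ?subset_leq_card // card_imset //.
rewrite !IHps // def_d natrM exprMn; field.
by rewrite expf_neq0 // pnatr_eq0 -lt0n.
Qed.

Lemma prod_primes_dvd d (ps : seq nat) : all prime ps -> uniq ps ->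
  all (fun p => p %| d)%N ps -> (\prod_(p <- ps) p %| d)%N.
Proof.
elim: ps => [|p ps IHps] /=; first by rewrite big_nil.
case/andP=> p_pr ps_pr /andP[p_ps ups] /andP[pd psd].
rewrite big_cons Gauss_dvd ?pd ?IHps //.
rewrite coprime_sym big_seq; elim/big_rec: _ => [|q x qps]; first exact: coprime1n.
have q_pr : prime q := allP ps_pr q qps.
rewrite coprimeMl => ->; rewrite andbT prime_coprime // dvdn_prime2 //.
by apply: contraNneq p_ps => <-.
Qed.

Lemma card_coprime_tuples_ge m d : (0 < d)%N ->
  d%:R ^+ m * \prod_(p <- primes d) (1 - (p%:R ^+ m)^-1) <=
  #|coprime_tuples m d|%:R :> R.
Proof.
move=> d_gt0; have pr_d : all prime (primes d).
  by apply/allP => p; rewrite mem_primes => /andP[].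
have dvd_d : all (fun p => p %| d)%N (primes d).
  by apply/allP => p; rewrite mem_primes => /and3P[].
rewrite -card_sieved_tuples ?prod_primes_dvd ?primes_uniq //.
rewrite ler_nat; apply/subset_leq_card/fintype.subsetP => t; rewrite !inE => /allP ht.
rewrite /coprime; set g := gcdn _ _.
have g_gt0 : (0 < g)%N by rewrite gcdn_gt0 d_gt0 orbT.
rewrite eqn_leq g_gt0 andbT leqNgt; apply/negP => g_gt1.
have pg := pdiv_dvd g; have p_pr := pdiv_prime g_gt1.
have /ht/existsP[i /negP] : pdiv g \in primes d.
  by rewrite mem_primes p_pr d_gt0 (dvdn_trans pg) ?dvdn_gcdr.
apply; apply: dvdn_trans pg (dvdn_trans (dvdn_gcdl _ _) _).
exact: (dvdn_biggcdP _ _ _ (dvdnn _)).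
Qed.

End Sieve.

Section ZetaBounds.
Variables (R : realType) (s : nat).

(** Partial sums of the Dirichlet series of zeta with the Euler factors at [ps] removed. *)
Definition sieved_zeta (ps : seq nat) (N : nat) : R :=
  \sum_(1 <= k < N.+1 | all (fun p => ~~ (p %| k)%N) ps) (k%:R ^+ s)^-1.

Lemma sieved_zeta0 N :
  sieved_zeta [::] N = series (fun k : nat => ((k.+1%:R : R) ^+ s)^-1) N.
Proof. by rewrite /sieved_zeta /series /= big_add1. Qed.

Lemma sieved_zeta_le ps N N' : (N <= N')%N -> sieved_zeta ps N <= sieved_zeta ps N'.
Proof.
move=> NN'; rewrite /sieved_zeta [leRHS](@big_cat_nat _ _ _ N.+1) //= lerDl.
by apply: sumr_ge0 => k _; rewrite invr_ge0 exprn_ge0.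
Qed.

(** The multiples of [p] up to [p * N] are the [p * j] with [j <= N], and [j] passes the sieve by
    [ps] exactly when [p * j] does. *)
Lemma sieved_zeta_cons p ps N : prime p -> all prime ps -> p \notin ps ->
  sieved_zeta ps (p * N) =
  sieved_zeta (p :: ps) (p * N) + (p%:R ^+ s)^-1 * sieved_zeta ps N.
Proof.
move=> p_pr ps_pr p_ps; have p_gt0 := prime_gt0 p_pr.
rewrite /sieved_zeta (bigID (fun k => p %| k)%N) /= addrC; congr (_ + _).
  by apply: eq_bigl => k; rewrite andbC.
rewrite big_distrr /=.
transitivity (\sum_(k <- [seq p * j | j <- index_iota 1 N.+1]%N |
    all (fun p => ~~ (p %| k)%N) ps) ((k%:R : R) ^+ s)^-1).
  rewrite [LHS](eq_bigl (fun k => (p %| k)%N && all (fun p => ~~ (p %| k)%N) ps)); last first.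
    by move=> k; rewrite andbC.
  rewrite -big_filter_cond; apply: perm_big; apply: uniq_perm.
  - by rewrite filter_uniq ?iota_uniq.
  - rewrite map_inj_uniq ?iota_uniq // => x y /eqP.
    by rewrite eqn_pmul2l // => /eqP.
  move=> k; rewrite mem_filter mem_index_iota; apply/andP/mapP.
    case=> /dvdnP[j ->]; rewrite mulnC !ltnS leq_pmul2l // muln_gt0 p_gt0 => /= j_itv.
    by exists j => //; rewrite mem_index_iota !ltnS.
  case=> j; rewrite mem_index_iota !ltnS => /andP[j1 jN] ->.
  by rewrite dvdn_mulr // muln_gt0 p_gt0 j1 leq_pmul2l.
rewrite big_map; apply: eq_big => [j|j _]; last by rewrite natrM exprMn invfM.
apply: eq_in_all => q qps; have q_pr : prime q := allP ps_pr q qps.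
rewrite Gauss_dvdr // prime_coprime // dvdn_prime2 //.
by apply: contraNneq p_ps => <-.
Qed.

Hypothesis s_ge2 : (2 <= s)%N.

(** For [k >= 4], the term [k^-s] is at most [4^-(s-2)] times [1/(k-1) - 1/k], which telescopes. The
    first three terms are kept exact for the sake of the constants below. *)
Lemma series_zeta_le N : (3 <= N)%N ->
  series (fun k : nat => ((k.+1%:R : R) ^+ s)^-1) N <=
  1 + (2 ^+ s)^-1 + (3 ^+ s)^-1 + (4 ^+ (s - 2))^-1 * (3^-1 - N%:R^-1).
Proof.
elim: N => // N IHN; rewrite leq_eqVlt => /orP[/eqP <-|].
  rewrite !seriesS seriesEnat /= big_geq // addr0. rewrite subrr mulr0 expr1n invr1; lra.
rewrite ltnS => N3; rewrite seriesS /= addrC.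
apply: le_trans (lerD (IHN N3) (lexx _)) _.
have [t ->] : exists t, s = (t + 2)%N by exists (s - 2)%N; rewrite subnK.
rewrite addnK [N.+1%:R ^+ _]exprD invfM.
have N0 : (3 : R) <= N%:R by rewrite ler_nat.
have h1 : (N.+1%:R ^+ t)^-1 <= (4 ^+ t)^-1 :> R.
  rewrite lef_pV2 ?posrE ?exprn_gt0 // lerXn2r ?nnegrE //.
  by rewrite ler_nat.
have h2 : (N.+1%:R ^+ 2)^-1 <= N%:R^-1 - N.+1%:R^-1 :> R.
  rewrite -natr1 -subr_ge0.
  have -> : N%:R^-1 - (N%:R + 1)^-1 - ((N%:R + 1) ^+ 2)^-1 =
     (N%:R * (N%:R + 1) ^+ 2)^-1 :> R.
    by field; apply/andP; split; apply: lt0r_neq0; lra.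
  by rewrite invr_ge0 mulr_ge0 ?exprn_ge0 //; lra.
have h3 : 0 <= (N.+1%:R ^+ 2)^-1 :> R by rewrite invr_ge0 exprn_ge0.
have h4 : 0 <= (N.+1%:R ^+ t)^-1 :> R by rewrite invr_ge0 exprn_ge0.
have := ler_pM h4 h3 h1 h2.
set A := _^-1 * _^-1; set D := (4 ^+ t)^-1; set E : R := 1 + _ + _.
move: A D E (N%:R^-1) (N.+1%:R^-1) => A D E x y; lra.
Qed.

Lemma is_cvg_series_zeta : cvgn (series (fun k : nat => ((k.+1%:R : R) ^+ s)^-1)).
Proof.
apply: nondecreasing_is_cvgn.
  by apply/nondecreasing_series => k _ _; rewrite invr_ge0 exprn_ge0.
exists (1 + (2 ^+ s)^-1 + (3 ^+ s)^-1 + (4 ^+ (s - 2))^-1 * 3^-1) => _ [N _ <-].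
apply: (@le_trans _ _ (series (fun k : nat => ((k.+1%:R : R) ^+ s)^-1) (N + 3)%N)).
  rewrite -!sieved_zeta0; apply: sieved_zeta_le; exact: leq_addr.
apply: le_trans (series_zeta_le _) _; first exact: leq_addl.
rewrite lerD2l ler_wpM2l ?invr_ge0 ?exprn_ge0 //.
by rewrite lerBlDr lerDl invr_ge0.
Qed.

Lemma zeta_le : zeta R s <= 1 + (2 ^+ s)^-1 + (3 ^+ s)^-1 + (4 ^+ (s - 2))^-1 * 3^-1.
Proof.
apply: limr_le; first exact: is_cvg_series_zeta.
near=> N; apply: le_trans (series_zeta_le _) _.
  by near: N; exact: nbhs_infty_ge.
rewrite lerD2l ler_wpM2l ?invr_ge0 ?exprn_ge0 //.
by rewrite lerBlDr lerDl invr_ge0.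
Unshelve. all: by end_near.
Qed.

(** [C] is the supremum of the sieved sums. Stated as two inequalities, this passes through
    [sieved_zeta_cons] without manipulating limits. *)
Lemma sieved_zeta_sup ps : all prime ps -> uniq ps ->
  let C := zeta R s * \prod_(p <- ps) (1 - (p%:R ^+ s)^-1) in
  (forall N, sieved_zeta ps N <= C) /\
  (forall e, 0 < e -> exists N, C - e < sieved_zeta ps N).
Proof.
elim: ps => [_ _|p ps IHps] /=.
  rewrite big_nil mulr1; split=> [N|e e_gt0].
    rewrite sieved_zeta0; apply: nondecreasing_cvgn_le is_cvg_series_zeta N.
    by apply/nondecreasing_series => k _ _; rewrite invr_ge0 exprn_ge0.
  have /cvgrPdist_lt/(_ e e_gt0) := is_cvg_series_zeta.
  case=> N _ /(_ N (leqnn N)) /=; rewrite ltr_norml => /andP[_ h]; exists N.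
  by rewrite sieved_zeta0 ltrBlDl -ltrBlDr.
case/andP=> p_pr ps_pr /andP[p_ps ups]; have [ub adh] := IHps ps_pr ups.
rewrite big_cons; set C := _ * _ in ub adh; rewrite mulrCA -/C.
have p_gt0 := prime_gt0 p_pr; set x := (p%:R ^+ s)^-1.
have x_itv : 0 <= x <= 1.
  rewrite invr_ge0 exprn_ge0 //= invf_le1 ?exprn_gt0 ?ltr0n //.
  by rewrite exprn_ege1 // ler1n.
have cons N := sieved_zeta_cons N p_pr ps_pr p_ps.
split=> [N|e e_gt0].
  (* At [N'] the sum sieved by [ps] is within [e] of its supremum; the recurrence is used at the
     larger of the two indices. *)
  apply/ler_addgt0Pr => e e_gt0; have [N' hN'] := adh e e_gt0.
  have h1 : sieved_zeta (p :: ps) N <= sieved_zeta (p :: ps) (p * maxn N N').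
    by apply/sieved_zeta_le/(leq_trans (leq_maxl N N')); rewrite leq_pmull.
  have h2 : sieved_zeta ps N' <= sieved_zeta ps (maxn N N').
    exact/sieved_zeta_le/leq_maxr.
  have := cons (maxn N N'); have := ub (p * maxn N N')%N; rewrite -/x; nra.
have [N hN] := adh e e_gt0; exists (p * N)%N.
have h1 : sieved_zeta ps N <= sieved_zeta ps (p * N).
  by apply: sieved_zeta_le; rewrite leq_pmull.
have := cons N; have := ub N; rewrite -/x; nra.
Qed.

(** The term [k = 1] survives every sieve. *)
Lemma zeta_euler_ge1 ps : all prime ps -> uniq ps ->
  1 <= zeta R s * \prod_(p <- ps) (1 - (p%:R ^+ s)^-1).
Proof.
move=> ps_pr ups; have [ub _] := sieved_zeta_sup ps_pr ups.
apply: le_trans (ub 1%N); rewrite /sieved_zeta big_mkcond big_nat1.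
rewrite expr1n invr1; case: ifP => // /negP; case.
by apply/allP => p /(allP ps_pr) p_pr; rewrite dvdn1 neq_ltn prime_gt1 // orbT.
Qed.

Lemma zeta_ge1 : 1 <= zeta R s.
Proof. by have := @zeta_euler_ge1 [::] isT isT; rewrite big_nil mulr1. Qed.

Lemma card_coprime_tuples_zeta d : (0 < d)%N ->
  d%:R ^+ s * (zeta R s)^-1 <= #|coprime_tuples s d|%:R.
Proof.
move=> d_gt0; apply: le_trans (card_coprime_tuples_ge R s d_gt0).
have z_gt0 : 0 < zeta R s by apply: lt_le_trans zeta_ge1.
rewrite ler_wpM2l ?exprn_ge0 // -[leRHS](mulKf (lt0r_neq0 z_gt0)) ler_peMr //.
  by rewrite invr_ge0 ltW.
apply: zeta_euler_ge1; last exact: primes_uniq.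
by apply/allP => p; rewrite mem_primes => /andP[].
Qed.

End ZetaBounds.

(** * Numerical estimates *)

Section Numerics.
Variable R : realType.

Lemma zeta2_le : zeta R 2 <= (17 / 10).
Proof. by apply: le_trans (@zeta_le R 2 isT) _; rewrite /= expr0; lra. Qed.

Lemma zeta3_le : zeta R 3 <= (5 / 4).
Proof. by apply: le_trans (@zeta_le R 3 isT) _; rewrite /= expr1; lra. Qed.

Lemma zeta4_le : zeta R 4 <= (11 / 10).
Proof. by apply: le_trans (@zeta_le R 4 isT) _; lra. Qed.

(** At [i = 5] the bound of [zeta_le] exceeds 1 by about [1.2984 * 2^-5]; the powers of 3 and 4 then
    decay faster than those of 2. *)
Lemma zeta_tail_le i : (5 <= i)%N -> zeta R i <= 1 + (13 / 10) * (2 ^+ i)^-1.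
Proof.
move=> i5; apply: le_trans (@zeta_le R i _) _; first exact: leq_trans i5.
have [j ->] : exists j, i = (j + 5)%N by exists (i - 5)%N; rewrite subnK.
have -> : (j + 5 - 2 = j + 3)%N by rewrite -addnBA.
rewrite !exprD !invfM.
have h2 : 0 < (2 ^+ j)^-1 :> R by rewrite invr_gt0 exprn_gt0.
have h3 : (3 ^+ j)^-1 <= (2 ^+ j)^-1 :> R.
  by rewrite lef_pV2 ?posrE ?exprn_gt0 // lerXn2r ?nnegrE //; lra.
have h4 : (4 ^+ j)^-1 <= (2 ^+ j)^-1 :> R.
  by rewrite lef_pV2 ?posrE ?exprn_gt0 // lerXn2r ?nnegrE //; lra.
move: ((2 ^+ j)^-1) ((3 ^+ j)^-1) ((4 ^+ j)^-1) h2 h3 h4 => x y z; lra.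
Qed.

Lemma prod_zeta_ge1 n : 1 <= \prod_(2 <= i < n.+2) zeta R i.
Proof.
rewrite big_seq; elim/big_rec: _ => // i x; rewrite mem_index_iota => /andP[i2 _] x1.
by rewrite -[1]mulr1 ler_pM // zeta_ge1.
Qed.

Lemma prod_zeta_le n : (3 <= n)%N -> \prod_(2 <= i < n.+2) zeta R i <= (51 / 20).
Proof.
(* A deficit is added so that the induction closes. Since [663/200 = 51/20 * 13/10], halving the
   deficit absorbs the new factor [1 + 13/10 * 2^-(n+2)]. *)
move=> n3; suff : \prod_(2 <= i < n.+2) zeta R i <= (51 / 20) - (663 / 200) * (2 ^+ n.+1)^-1.
  have : 0 < (2 ^+ n.+1)^-1 :> R by rewrite invr_gt0 exprn_gt0.
  by move: (\prod_(_ <= _ < _) _) ((2 ^+ n.+1)^-1) => P x; lra.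
elim: n n3 => [|n IHn]; first by rewrite ltn0.
rewrite leq_eqVlt => /orP[/eqP<-|].
  have -> : \prod_(2 <= i < 5) zeta R i = zeta R 2 * zeta R 3 * zeta R 4.
    by rewrite 3?big_ltn // big_geq // mulr1 ?mulrA.
  have := zeta2_le; have := zeta3_le; have := zeta4_le.
  have := @zeta_ge1 R 2 isT; have := @zeta_ge1 R 3 isT; have := @zeta_ge1 R 4 isT.
  move: (zeta R 2) (zeta R 3) (zeta R 4) => x y z z1 y1 x1 hz hy hx.
  have xy : x * y <= (17 / 10) * (5 / 4) by apply: ler_pM; lra.
  have xy0 : 0 <= x * y by nra.
  have xyz : x * y * z <= (17 / 10) * (5 / 4) * (11 / 10).
    by apply: ler_pM => [||//|]; lra.
  lra.
rewrite ltnS => n3; rewrite big_nat_recr //=; have {IHn} := IHn n3.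
have := @zeta_tail_le n.+2 _; rewrite !ltnS => /(_ n3).
have := @zeta_ge1 R n.+2 isT; have := prod_zeta_ge1 n.
rewrite [2 ^+ n.+2]exprS invfM.
have : 0 < (2 ^+ n.+1)^-1 :> R by rewrite invr_gt0 exprn_gt0.
move: (zeta R n.+2) (\prod_(_ <= _ < _) _) ((2 ^+ n.+1)^-1) => z P x x0 P1 z1 hz hP.
apply: le_trans (_ : ((51 / 20) - (663 / 200) * x) * (1 + (13 / 10) * (2^-1 * x)) <= _).
  by apply: ler_pM; lra.
nra.
Qed.

(** The Weierstrass product inequality; with constant [x] it is Bernoulli's. *)
Lemma prod_subr1_ge n (x : nat -> R) : (forall k, (k < n)%N -> 0 <= x k <= 1) ->
  1 - \sum_(k < n) x k <= \prod_(k < n) (1 - x k) <= 1.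
Proof.
elim: n => [|n IHn] hx; first by rewrite !big_ord0; lra.
rewrite !big_ord_recr /=.
have /IHn/andP[] : forall k, (k < n)%N -> 0 <= x k <= 1.
  by move=> k kn; apply: hx; apply: leqW.
have := hx n (leqnn _).
have : 0 <= \prod_(k < n) (1 - x k).
  by apply: prodr_ge0 => k _; have /andP[_] := hx k (leqW (ltn_ord k)); rewrite subr_ge0.
move: (\prod_(k < n) _) (\sum_(k < n) _) (x n) => P S y; nra.
Qed.

End Numerics.

Section IndependenceNumerics.
Variables (R : realType) (n : nat).
Let s : R := Num.sqrt n%:R.
Let Q := 4 * s ^+ n + 1.
Let W := 4 * s ^+ n - 1.
(** [c k] is the bound that geometry gives for a subspace of dimension [k], and [d k] is the term in
    [alpha]. They are not ordered term by term ([c 1 > d 1] for [n = 5]), so the products are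
    compared as wholes. *)
Let c k := Num.sqrt k.+1%:R ^+ (n - k) * Q ^+ k / W ^+ n.
Let d k := s ^+ k * Q ^+ k / W ^+ n.

Let s2 : s ^+ 2 = n%:R. Proof. by rewrite sqr_sqrtr. Qed.

Section Large.
Hypothesis n3 : (3 <= n)%N.

Let s_ge : 17 / 10 <= s.
Proof.
have s0 : 0 <= s by rewrite sqrtr_ge0.
have : 3 <= s ^+ 2 by rewrite s2 ler_nat.
nra.
Qed.

Let sn_ge : n%:R * s <= s ^+ n.
Proof.
have -> : s ^+ n = s ^+ (n - 3) * s ^+ 3 by rewrite -exprD subnK.
rewrite exprSr s2 -[leLHS]mul1r ler_wpM2r ?exprn_ege1 //; have := s_ge; first last.
  by lra.
by move=> ?; rewrite mulr_ge0 //; lra.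
Qed.

Let n_ge : 3 <= n%:R :> R. Proof. by rewrite ler_nat. Qed.

Let Q_ge : 4 * n%:R * s <= Q.
Proof. by rewrite /Q; have := sn_ge; lra. Qed.

Let Q_gt1 : 1 < Q. Proof. by have := Q_ge; have := s_ge; have := n_ge; nra. Qed.

Let W_gt0 : 0 < W.
Proof. by have := sn_ge; have := s_ge; have := n_ge; rewrite /W; nra. Qed.

Let Wn_gt0 : 0 < W ^+ n. Proof. by rewrite exprn_gt0. Qed.

(** Bernoulli's inequality for [W = Q * (1 - 2 / Q)]. *)
Let Wn_ge : Q ^+ n.-1 * (Q - 2 * n%:R) <= W ^+ n.
Proof.
have Q0 : 0 < Q by apply: lt_trans Q_gt1.
have [] := andP (@prod_subr1_ge R n (fun=> 2 / Q) _).
  move=> _ _; apply/andP; split; first by rewrite divr_ge0 // ltW.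
  by rewrite ler_pdivrMr // mul1r; have := Q_ge; have := s_ge; have := n_ge; nra.
rewrite sumr_const prodr_const card_ord => + _ => h.
have -> : W ^+ n = Q ^+ n * (1 - 2 / Q) ^+ n.
  by rewrite -exprMn; congr (_ ^+ _); rewrite /W /Q; field; rewrite -/Q gt_eqF.
have n0 : (0 < n)%N by apply: leq_trans n3.
have -> : Q ^+ n = Q ^+ n.-1 * Q by rewrite -exprSr prednK.
rewrite -mulrA ler_wpM2l ?exprn_ge0 ?(ltW Q0) //.
apply: le_trans (ler_wpM2l (ltW Q0) h).
have -> : Q * (1 - (2 / Q) *+ n) = Q - 2 * n%:R; last exact: lexx.
by rewrite -[_ *+ n]mulr_natl; field; rewrite gt_eqF.
Qed.

Let c_lastE : c n.-1 = s * Q ^+ n.-1 / W ^+ n.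
Proof.
have n0 : (0 < n)%N by apply: leq_trans n3.
have e : (n - n.-1 = 1)%N by rewrite -subn1 subKn.
by rewrite /c e expr1 prednK.
Qed.

(** By [Wn_ge] this is at most [s^(n-1) / (Q - 2 n)]. As [n <= s^(n-1)] and [s >= 17/10], the
    quotient is at most [5/24]. *)
Let d_last : 0 <= d n.-1 <= 21 / 100.
Proof.
have Q0 : 0 < Q by apply: lt_trans Q_gt1.
have s0 : 0 < s by have := s_ge; lra.
have p0 : 0 < Q ^+ n.-1 by rewrite exprn_gt0.
have q0 : 0 < s ^+ n.-1 by rewrite exprn_gt0.
rewrite /d divr_ge0 ?mulr_ge0 ?(ltW p0) ?(ltW q0) ?(ltW Wn_gt0) //=.
rewrite ler_pdivrMr //.
have hD : s ^+ n = s ^+ n.-1 * s by rewrite -exprSr prednK // (leq_trans _ n3).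
have h1 : s ^+ n.-1 * (24 / 5) <= Q - 2 * n%:R.
  have h2 : n%:R <= s ^+ n.-1 by rewrite -(ler_pM2r s0) -hD.
  by rewrite /Q hD; have := s_ge; nra.
have := Wn_ge; nra.
Qed.

Let d_small k : (k < n.-1)%N -> 0 <= d k /\ d k * (4 * n%:R) <= d n.-1.
Proof.
move=> kn; have s0 : 0 < s by have := s_ge; lra.
have Q0 : 0 < Q by apply: lt_trans Q_gt1.
have p0 : 0 <= (s * Q) ^+ k by rewrite exprn_ge0 // mulr_ge0 // ltW.
rewrite /d -!exprMn divr_ge0 ?(ltW Wn_gt0) //; split => //.
rewrite mulrAC ler_pM2r ?invr_gt0 //.
have -> : n.-1 = (k + (n.-1 - k.+1).+1)%N by rewrite addnS -addSn subnKC.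
rewrite exprD ler_wpM2l // exprS.
have t_ge : 4 * n%:R <= s * Q by have := Q_ge; have := s_ge; have := n_ge; nra.
rewrite -[leLHS]mulr1 ler_pM ?mulr_ge0 // exprn_ege1 //.
by have := n_ge; lra.
Qed.

(** The quotient of [d n.-1] by [c n.-1] is [s^(n-2)], which is at least [s]. *)
Let c_last : 0 <= c n.-1 /\ (17 / 10) * c n.-1 <= d n.-1.
Proof.
have s0 : 0 < s by have := s_ge; lra.
have Q0 : 0 < Q by apply: lt_trans Q_gt1.
have n0 : (0 < n)%N by apply: leq_trans n3.
rewrite c_lastE.
have p0 : 0 <= Q ^+ n.-1 / W ^+ n by rewrite divr_ge0 ?exprn_ge0 ?(ltW Wn_gt0) // ltW.
rewrite /d -[s * _ / _]mulrA -[s ^+ _ * _ / _]mulrA.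
move: p0; set p := Q ^+ _ / _ => p0; split; first by rewrite mulr_ge0 // ltW.
rewrite mulrA ler_wpM2r //.
have -> : n.-1 = (2 + (n.-1 - 2))%N by rewrite subnKC // -ltnS prednK.
rewrite exprD.
have h : 1 <= s ^+ (n.-1 - 2) by rewrite exprn_ege1 //; have := s_ge; lra.
have s2_ge : 17 / 10 * s <= s ^+ 2 by rewrite expr2 ler_wpM2r ?s_ge // ltW.
have : 0 <= s ^+ 2 by rewrite exprn_ge0 // ltW.
by move: (s ^+ (n.-1 - 2)) (s ^+ 2) h s2_ge => a b; nra.
Qed.

Let c_small k : (k < n.-1)%N -> 0 <= c k /\ c k * (4 * n%:R) <= c n.-1.
Proof.
move=> kn; have s0 : 0 < s by have := s_ge; lra.
have Q0 : 0 < Q by apply: lt_trans Q_gt1.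
have n0 : (0 < n)%N by apply: leq_trans n3.
have ck0 : 0 <= Q ^+ k / W ^+ n by rewrite divr_ge0 ?exprn_ge0 ?(ltW Wn_gt0) // ltW.
split; first by rewrite /c -mulrA mulr_ge0 // exprn_ge0 // sqrtr_ge0.
apply: (@le_trans _ _ (s ^+ (n - k) * Q ^+ k / W ^+ n * (4 * n%:R))).
  rewrite ler_wpM2r ?mulr_ge0 // /c -!mulrA ler_wpM2r //.
  apply: lerXn2r; rewrite ?nnegrE ?sqrtr_ge0 //.
  by rewrite ler_sqrt // ler_nat; apply: leq_trans kn (leq_pred _).
rewrite c_lastE mulrAC ler_pM2r ?invr_gt0 //.
have [j e] : exists j, n.-1 = (k + j.+1)%N.
  by exists (n.-1 - k.+1)%N; rewrite addnS -addSn subnKC.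
have -> : (n - k = j.+2)%N by rewrite -(prednK n0) e -addnS addKn.
rewrite e exprD !exprS.
have h1 : s * (4 * n%:R) <= Q by have := Q_ge; lra.
have h2 : s ^+ j <= Q ^+ j.
  apply: lerXn2r; rewrite ?nnegrE ?(ltW s0) ?(ltW Q0) //.
  by have := n_ge; have := s_ge; nra.
have h3 : s * (4 * n%:R) * s ^+ j <= Q * Q ^+ j.
  by apply: ler_pM => //; rewrite ?exprn_ge0 ?mulr_ge0 // ltW.
have h4 : 0 <= s * Q ^+ k by apply: mulr_ge0; [|apply: exprn_ge0]; exact: ltW.
have := ler_wpM2l h4 h3.
set a := s ^+ j; set b := Q ^+ k; set b' := Q ^+ j; lra.
Qed.

Let sum_small (x : nat -> R) :
  (forall k, (k < n.-1)%N -> 0 <= x k /\ x k * (4 * n%:R) <= x n.-1) ->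
  0 <= x n.-1 -> \sum_(k < n) x k <= 5 / 4 * x n.-1.
Proof.
move=> hx x0; have n0 : (0 < n)%N by apply: leq_trans n3.
have -> : \sum_(k < n) x k = \sum_(k < n.-1) x k + x n.-1.
  by rewrite -[in LHS](prednK n0) big_ord_recr.
have : \sum_(k < n.-1) x k <= \sum_(k < n.-1) (x n.-1 / (4 * n%:R)).
  apply: ler_sum => k _; rewrite ler_pdivlMr; first by case: (hx k (ltn_ord k)).
  by have := n_ge; lra.
rewrite sumr_const card_ord -[in X in _ <= X -> _]mulr_natl.
have : n.-1%:R * (x n.-1 / (4 * n%:R)) <= x n.-1 / 4.
  have -> : n.-1%:R * (x n.-1 / (4 * n%:R)) = (n.-1%:R / n%:R) * (x n.-1 / 4).
    by field; rewrite pnatr_eq0 -lt0n.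
  rewrite -[leRHS]mul1r ler_wpM2r ?divr_ge0 // ler_pdivrMr ?ltr0n //.
  by rewrite mul1r ler_nat leq_pred.
lra.
Qed.

(** The last terms dominate: each sum is at most [5/4] of its last term. Thus the product with [d]
    is at least [1 - 5/4 * 21/100], and it is at most [1 - d n.-1 <= 1 - 17/10 * c n.-1], which is
    below the bound [1 - 5/4 * c n.-1] for the product with [c]. *)
Lemma indep_numerics_large :
  [/\ forall k, (k < n)%N -> 0 <= c k <= 1,
      \prod_(k < n) (1 - d k) <= \prod_(k < n) (1 - c k) &
      18 / 25 <= \prod_(k < n) (1 - d k)].
Proof.
have n0 : (0 < n)%N by apply: leq_trans n3.
have [e0 e1] := andP d_last; have [f0 f1] := c_last.
have dP k : (k < n)%N -> 0 <= d k <= 1.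
  rewrite -{1}(prednK n0) ltnS leq_eqVlt => /orP[/eqP->|/d_small[]]; first by lra.
  by have := n_ge; nra.
have cP k : (k < n)%N -> 0 <= c k <= 1.
  rewrite -{1}(prednK n0) ltnS leq_eqVlt => /orP[/eqP->|/c_small[]]; first by lra.
  by have := n_ge; nra.
have Sd := sum_small d_small e0; have Sc := sum_small c_small f0.
have /andP[pd _] := prod_subr1_ge dP; have /andP[pc _] := prod_subr1_ge cP.
split => //; last by lra.
have pd1 : \prod_(k < n) (1 - d k) <= 1 - d n.-1.
  have -> : \prod_(k < n) (1 - d k) = \prod_(k < n.-1) (1 - d k) * (1 - d n.-1).
    by rewrite -[in LHS](prednK n0) big_ord_recr.
  have /prod_subr1_ge/andP[_ h] : forall k, (k < n.-1)%N -> 0 <= d k <= 1.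
    by move=> k kn; apply: dP; apply: leq_trans kn (leq_pred _).
  rewrite -[leRHS]mul1r ler_wpM2r //; lra.
lra.
Qed.

End Large.

Lemma indep_numerics : (1 <= n)%N ->
  [/\ forall k, (k < n)%N -> 0 <= c k <= 1,
      \prod_(k < n) (1 - d k) <= \prod_(k < n) (1 - c k) &
      (33 / 50 <= \prod_(k < n) (1 - d k))].
Proof.
have [n3 _|] := leqP 3 n.
  by have [? ? h] := indep_numerics_large n3; split => //; lra.
(* For [n = 1] and [n = 2] the terms of [c] and [d] coincide. The case [n = 1] has product [2/3],
   whence the constant [33/50]. *)
rewrite ltnS leq_eqVlt => /orP[/eqP n2|]; last first.
  rewrite ltnS => n1 n1'; have {n1 n1'} n1 : n = 1%N by apply/eqP; rewrite eqn_leq n1.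
  have s1 : s = 1 by rewrite /s n1 sqrtr1.
  have c0 : c 0%N = 3^-1 by rewrite /c /W s1 n1 !expr1n expr0 sqrtr1 !expr1; field.
  have d0 : d 0%N = 3^-1 by rewrite /d /W s1 n1 !expr1n !expr0 !expr1; field.
  split.
  - by rewrite n1 => -[|k] // _; rewrite c0; lra.
  - by rewrite n1 !big_ord_recl !big_ord0 /= c0 d0.
  - by rewrite n1 !big_ord_recl !big_ord0 /= d0; lra.
move=> _; have s2' : s ^+ 2 = 2 by rewrite s2 n2.
have s0 : 0 <= s by rewrite sqrtr_ge0.
have s_le : s <= 17 / 12 by nra.
have c0 : c 0%N = (49)^-1.
  by rewrite /c /W n2 s2' sqrtr1 expr1n expr0; field.
have c1 : c 1%N = s * (9 / 49).
  by rewrite /c /W /Q n2 s2' -/s /s n2 subn1 /= !expr1; field.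
have d0 : d 0%N = (49)^-1 by rewrite /d /W n2 s2' !expr0; field.
have d1 : d 1%N = s * (9 / 49) by rewrite /d /W /Q n2 s2' !expr1; field.
split.
- by rewrite n2 => -[|[|k]] // _; rewrite ?c0 ?c1; lra.
- by rewrite n2 !big_ord_recl !big_ord0 /= c0 c1 d0 d1.
- by rewrite n2 !big_ord_recl !big_ord0 /= d0 d1; lra.
Qed.

Lemma alpha_numerics : (1 <= n)%N ->
  4^-1 <= \prod_(2 <= i < n.+2) (zeta R i)^-1 /\ 92 / 1000 <= alpha R n.
Proof.
move=> n1; have [_ _ y66] := indep_numerics n1.
have P0 : 0 < \prod_(2 <= i < n.+2) zeta R i by apply: lt_le_trans (prod_zeta_ge1 _ _).
(* [b] bounds the zeta product from above and [y] the other product from below; [b^-1 >= 1/4] makes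
   the first factor of [alpha] nonnegative. *)
suff : exists b y, [/\ \prod_(2 <= i < n.+2) zeta R i <= b, y <= \prod_(k < n) (1 - d k),
    0 < b, 0 <= y & 4^-1 <= b^-1 /\ 92 / 1000 <= (b^-1 - 4^-1) * y].
  case=> b [y [hb hy b0 y0 [b4 hby]]]; rewrite prodfV.
  have hb' : b^-1 <= (\prod_(2 <= i < n.+2) zeta R i)^-1 by rewrite lef_pV2 ?posrE.
  split; first exact: le_trans b4 hb'.
  rewrite /alpha prodfV; apply: le_trans hby _.
  by apply: ler_pM => //; rewrite ?subr_ge0 // lerD2r.
have [n3|n3] := leqP 3 n.
  have [_ _ h] := indep_numerics_large n3.
  exists (51 / 20), (18 / 25); split; first [exact: prod_zeta_le | lra].
exists (17 / 8), (33 / 50); split; try exact: y66; try lra.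
have z2 := zeta2_le R; have z3 := zeta3_le R.
have y2 := @zeta_ge1 R 2 isT; have y3 := @zeta_ge1 R 3 isT.
have [->|->] : n = 1%N \/ n = 2%N by lia.
  by rewrite big_nat1; lra.
have -> : \prod_(2 <= i < 4) zeta R i = zeta R 2 * zeta R 3.
  by rewrite 2?big_ltn // big_geq // mulr1 ?mulrA.
have : zeta R 2 * zeta R 3 <= (17 / 10) * (5 / 4) by apply: ler_pM; lra.
lra.
Qed.

End IndependenceNumerics.

(** * Packing and covering *)

(** Continuity at 0 from the right. It serves twice: with [e] the inverse of the side of a growing
    box, and with [e] the excess of a radius over the covering radius. *)
Lemma horner0_le (R : realType) (p q : {poly R}) (e0 : R) : 0 < e0 ->
  (forall e, 0 < e < e0 -> p.[e] <= q.[e]) -> p.[0] <= q.[0].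
Proof.
move=> e0_gt0 le_pq.
apply: (@ler_cvg_to _ 0^'+ _ _ (horner p) (horner q)).
- by apply: cvg_at_right_filter; exact: continuous_horner.
- by apply: cvg_at_right_filter; exact: continuous_horner.
- near=> e; apply: le_pq; apply/andP; split; first by [].
  by near: e; exact: nbhs_right_lt.
Unshelve. all: by end_near.
Qed.

Lemma ltz_ltP1 (R : realType) (m m' : int) (w x y a : R) : 0 < w ->
  a <= x < a + w -> a <= y < a + w -> x + w * m%:~R = y + w * m'%:~R -> m = m'.
Proof.
move=> w0 hx hy e.
have e2 : w * (m - m')%:~R = y - x by rewrite rmorphB /= mulrBr; lra.
have h1 : ((m - m')%:~R : R) < 1%:~R.
  by rewrite -(ltr_pM2l w0) e2 mulr1; lra.
have h2 : ((m' - m)%:~R : R) < 1%:~R.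
  by rewrite -(ltr_pM2l w0) mulr1 -opprB rmorphN /= mulrN e2; lra.
move: h1 h2; rewrite !ltr_int; lia.
Qed.

Lemma natr_card_dffun (R : realType) n (M : 'I_n -> nat) :
  (#|{dffun forall j : 'I_n, 'I_(M j)}|%:R : R) = \prod_j (M j)%:R.
Proof.
rewrite card_dep_ffun foldrE big_map big_enum /= natr_prod.
by apply: eq_bigr => j _; rewrite card_ord.
Qed.

Section Packing.
Variables (R : realType) (n : nat) (I J : finType).
Variables (u : I -> 'rV[R]_n) (v : J -> 'rV[R]_n) (X E : set 'rV[R]_n).
Variables (T : 'M[R]_n) (P : pred 'I_n) (a w : 'I_n -> R) (C d : R).
(** [T] reads only coordinates in [P] and writes only outside [P], so its square is zero and
    [x - x *m T] is a shear preserving volume. *)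
Hypothesis shearT : forall i j, T i j != 0 -> P i && ~~ P j.
Hypotheses (inj_u : injective u) (w_gt0 : forall j, 0 < w j).
Hypotheses (d_gt0 : 0 < d) (C_ge0 : 0 <= C).
(** The next two hypotheses stand in for density: [u] can be placed inside [X] near any point, and
    one translate of [v] accounts for all of [X] in any cube of side [d]. *)
Hypothesis packX : forall g : 'rV[R]_n, exists t : 'rV[R]_n, E (t - g) /\ forall i, X (u i + t).
Hypothesis coverX : forall g : 'rV[R]_n, exists t : 'rV[R]_n, forall y, X y ->
  (forall j, 0 <= (y - g) ord0 j < d) -> exists k, y = v k + t.
Hypothesis bound_uE : forall i e, E e -> forall j, `|(u i + e) ord0 j| <= C.
Hypothesis cell_uE : forall i e, E e -> forall j,
  a j <= (u i + e - (u i + e) *m T) ord0 j < a j + w j.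

(* Shifting coordinate [j] of the grid point [w * b] inside its own cell makes
   the sheared grid point an integer multiple of the widths. *)
Let z m (b : {dffun forall j : 'I_n, 'I_(m j)}) : 'rV[R]_n :=
  \row_j (w j * (b j)%:R).
Let g m (b : {dffun forall j : 'I_n, 'I_(m j)}) : 'rV[R]_n :=
  \row_j (z b ord0 j + w j * ((z b *m T) ord0 j / w j
             - (Num.floor ((z b *m T) ord0 j / w j))%:~R)).

Let zT_P m (b : {dffun forall j : 'I_n, 'I_(m j)}) j : P j -> (z b *m T) ord0 j = 0.
Proof.
move=> Pj; rewrite mxE big1 // => i _.
by have [->|/shearT] := eqVneq (T i j) 0; rewrite ?mulr0 // Pj andbF.
Qed.

Let gT m (b : {dffun forall j : 'I_n, 'I_(m j)}) : g b *m T = z b *m T.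
Proof.
apply/rowP => j; rewrite !mxE; apply: eq_bigr => i _.
have [->|/shearT/andP[Pi _]] := eqVneq (T i j) 0; first by rewrite !mulr0.
by congr (_ * _); rewrite mxE zT_P // mul0r floor0 subr0 mulr0 addr0.
Qed.

Let shear_g m (b : {dffun forall j : 'I_n, 'I_(m j)}) j :
  (g b - g b *m T) ord0 j =
  w j * ((b j)%:Z - Num.floor ((z b *m T) ord0 j / w j))%:~R.
Proof.
have w0 : w j != 0 by rewrite gt_eqF.
have -> : (g b - g b *m T) ord0 j = g b ord0 j - (z b *m T) ord0 j.
  by rewrite gT mxE; congr (_ + _); rewrite mxE.
rewrite mxE [z b ord0 j]mxE rmorphB /= -pmulrn; field; exact: w0.
Qed.

(** Coordinates in [P] are read off first, since [z b *m T] vanishes there; they determine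
    [z b *m T], and then the remaining coordinates. *)
Let shear_inj m (b b' : {dffun forall j : 'I_n, 'I_(m j)}) :
  (forall j, (b j)%:Z - Num.floor ((z b *m T) ord0 j / w j) =
             (b' j)%:Z - Num.floor ((z b' *m T) ord0 j / w j)) -> b = b'.
Proof.
move=> e.
have eP j : P j -> b j = b' j.
  move=> Pj; apply/val_inj; move: (e j).
  by rewrite !zT_P // mul0r floor0 !subr0 => -[].
have ez : z b *m T = z b' *m T.
  apply/rowP => j; rewrite !mxE; apply: eq_bigr => i _.
  have [->|/shearT/andP[Pi _]] := eqVneq (T i j) 0; first by rewrite !mulr0.
  by congr (_ * _); rewrite !mxE eP.
apply/ffunP => j; apply/val_inj; move: (e j).
by rewrite ez => /addIr[].
Qed.

(** The translates of [u] by vectors near the grid points give distinct points of [X] in the cube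
    with coordinates between [-C] and [S + C]. Cubes of side [d] tile a region containing it, and
    each holds at most [#|J|] points of [X]. *)
Let pack_count (S : R) : 0 < S ->
  #|I|%:R * \prod_j (Num.truncn (S / w j))%:R <=
  #|J|%:R * (Num.truncn ((S + 2 * C) / d)).+1%:R ^+ n :> R.
Proof.
move=> S_gt0; set M := fun j => Num.truncn (S / w j).
set K := (Num.truncn _).+1.
have [t ht] := choice packX; have [t' ht'] := choice coverX.
pose y (x : I * {dffun forall j : 'I_n, 'I_(M j)}) := u x.1 + t (g x.2).
have ysplit x : y x = (u x.1 + (t (g x.2) - g x.2)) + g x.2.
  by rewrite /y -addrA subrK.
have gbound (x : {dffun forall j : 'I_n, 'I_(M j)}) j : 0 <= g x ord0 j <= S.
  rewrite mxE [z x ord0 j]mxE; set th := _ / w j.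
  have /andP[f1 f2] := floor_itv th; rewrite intrD in f2.
  have w0 := w_gt0 j.
  have b1 : ((x j).+1%:R : R) <= S / w j.
    by rewrite -truncn_gt_nat; exact: ltn_ord.
  rewrite ler_pdivlMr // -natr1 in b1.
  have b2 : 0 <= ((x j)%:R : R) by [].
  have : 0 <= w j * (th - (Num.floor th)%:~R) <= w j by nra.
  have : 0 <= w j * (x j)%:R by rewrite mulr_ge0 // ltW.
  nra.
have ybound x j : 0 <= y x ord0 j + C <= S + 2 * C.
  have := bound_uE x.1 (ht (g x.2)).1 j; have := gbound x.2 j.
  rewrite ysplit [in X in _ -> _ -> X]mxE ler_norml; lra.
(* After the shear, each placed copy lies in a box of sides [w] shifted by an integer multiple of
   [w]; equality of two points forces equal shifts, hence equal grid indices. *)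
have y_inj : injective y.
  move=> x x' e.
  have eg : x.2 = x'.2.
    apply: shear_inj => j.
    apply: (@ltz_ltP1 _ _ _ (w j) _ _ (a j) (w_gt0 j)
             (cell_uE x.1 (ht (g x.2)).1 j) (cell_uE x'.1 (ht (g x'.2)).1 j)).
    rewrite -!shear_g.
    move: e; rewrite !ysplit; set A := _ + (_ - g x.2); set A' := _ + (_ - g x'.2).
    move=> e; have := congr1 (fun B => (B - B *m T) ord0 j) e.
    by rewrite !mulmxDl !opprD !(addrACA _ (g _)) mxE [in X in _ = X -> _]mxE.
  case: x x' e eg => [i b] [i' b'] /=; rewrite /y /= => + eb.
  by rewrite eb => /addIr /inj_u ->.
have hF x : exists r : {ffun 'I_n -> 'I_K} * J,
    y x = v r.2 + t' (\row_j (d * (r.1 j)%:R - C)).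
  have hK j : (Num.truncn ((y x ord0 j + C) / d) < K)%N.
    rewrite ltnS; apply: le_truncn; rewrite ler_pM2r ?invr_gt0 //.
    by case/andP: (ybound x j).
  pose r1 := [ffun j => Ordinal (hK j)] : {ffun 'I_n -> 'I_K}.
  have [|j|k hk] := ht' (\row_j (d * (r1 j)%:R - C)) (y x).
  - exact: (ht (g x.2)).2.
  - set yx := y x; have -> : (yx - \row_j (d * (r1 j)%:R - C)) ord0 j =
        yx ord0 j + C - d * (r1 j)%:R by rewrite !mxE; lra.
    rewrite ffunE /= {}/yx.
    have /truncn_itv/andP[] : 0 <= (y x ord0 j + C) / d.
      by rewrite divr_ge0 ?(ltW d_gt0) //; case/andP: (ybound x j).
    rewrite ler_pdivlMr // ltr_pdivrMr // -natr1; lra.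
  - by exists (r1, k).
have [F hFF] := choice hF.
have Finj : injective F by move=> x x' e; apply: y_inj; rewrite !hFF e.
have := leq_card F Finj.
rewrite !card_prod -(ler_nat R) !natrM natr_card_dffun card_ffun !card_ord natrX.
by rewrite [X in _ <= X]mulrC.
Qed.

(** [pack_count] with [S = e^-1] is multiplied by [e ^+ n], and [e] tends to 0. *)
Lemma packing : #|I|%:R * d ^+ n <= #|J|%:R * \prod_j w j.
Proof.
pose p : {poly R} := #|I|%:R%:P * \prod_j ((w j)^-1%:P - 'X).
(* [2 * C / d] comes from enlarging the cube and 1 from rounding the number of cells up. *)
have [D defD] : exists D, D = 2 * C / d + 1 by exists (2 * C / d + 1).
pose q : {poly R} := #|J|%:R%:P * (d^-1%:P + D%:P * 'X) ^+ n.
pose e0 := \big[Num.min/1]_j (w j)^-1.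
have e0_gt0 : 0 < e0 by apply: lt_bigmin => // j _; rewrite invr_gt0.
have : p.[0] <= q.[0].
  apply: (@horner0_le _ _ _ e0) => // e /andP[e_gt0 lt_ee0].
  rewrite /p /q !hornerE_comm /= horner_prod.
  have := @pack_count e^-1; rewrite invr_gt0 => /(_ e_gt0) h.
  have en : 0 <= e ^+ n by rewrite exprn_ge0 // ltW.
  have {h} := ler_wpM2r en h; rewrite -!mulrA => h.
  rewrite !hornerE; apply: le_trans (le_trans h _).
    rewrite ler_wpM2l //.
    have -> : e ^+ n = \prod_(j < n) e by rewrite prodr_const card_ord.
    rewrite -big_split /=; apply: ler_prod => j _; rewrite !hornerE.
    have w0 := w_gt0 j.
    have ew : e < (w j)^-1 by apply: lt_le_trans lt_ee0 _; exact: bigmin_le.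
    rewrite subr_ge0 (ltW ew) /=.
    have x0 : 0 <= e^-1 / w j by rewrite divr_ge0 // ltW // invr_gt0.
    have /andP[_] := truncn_itv x0.
    rewrite -(ltr_pM2r e_gt0) mulrAC mulVf ?gt_eqF // mul1r -natr1 mulrDl; lra.
  rewrite ler_wpM2l // -exprMn.
  have x0 : 0 <= (e^-1 + 2 * C) / d.
    by rewrite divr_ge0 ?addr_ge0 ?mulr_ge0 // ltW // invr_gt0.
  apply: lerXn2r; rewrite ?nnegrE.
  - by rewrite mulr_ge0 // ltW.
  - by rewrite defD addr_ge0 ?mulr_ge0 ?addr_ge0 ?divr_ge0 ?mulr_ge0 ?invr_ge0 // ltW.
  have /andP[le_tr _] := truncn_itv x0.
  have := ler_wpM2r (ltW e_gt0) le_tr.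
  have -> : (e^-1 + 2 * C) / d * e = d^-1 + 2 * C / d * e.
    by field; rewrite !gt_eqF.
  rewrite defD -natr1; lra.
rewrite /p /q !hornerE_comm horner_prod.
under eq_bigr do rewrite !hornerE subr0.
rewrite !hornerE prodfV exprVn => h.
have pw : 0 < \prod_j w j by apply: prodr_gt0 => j _.
have pd : 0 < d ^+ n by rewrite exprn_gt0.
by move: h; rewrite ler_pdivrMr // mulrAC ler_pdivlMr.
Qed.

End Packing.

(** * Lattices *)

Section Norm2.
Variables (R : realType) (n : nat).
Implicit Types x y : 'rV[R]_n.

Lemma norm2_ge_coord x i : `|x ord0 i| <= norm2 x.
Proof.
rewrite -sqrtr_sqr; apply: ler_wsqrtr; rewrite (bigD1 i) //= lerDl.
by apply: sumr_ge0 => j _; exact: sqr_ge0.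
Qed.

Lemma norm2_le_max x (m : R) : 0 <= m -> (forall i, `|x ord0 i| <= m) ->
  norm2 x <= n%:R * m.
Proof.
move=> m0 xm; rewrite -[leRHS](ger0_norm (mulr_ge0 _ m0)) // -sqrtr_sqr.
apply: ler_wsqrtr; apply: (@le_trans _ _ (\sum_(i < n) m ^+ 2)).
  by apply: ler_sum => i _; rewrite -[_ ^+ 2]real_normK ?num_real // lerXn2r ?nnegrE.
rewrite sumr_const card_ord -[_ *+ n]mulr_natl exprMn ler_wpM2r ?sqr_ge0 //.
by rewrite -natrX ler_nat; case: (n) => // k; rewrite leq_pmulr.
Qed.

Lemma norm2N x : norm2 (- x) = norm2 x.
Proof. by congr Num.sqrt; apply: eq_bigr => i _; rewrite mxE sqrrN. Qed.

End Norm2.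

Section Lattice.
Variables (R : realType) (n : nat) (L : set 'rV[R]_n).
Hypothesis latL : is_full_lattice L.

Lemma lattice0 : L 0. Proof. by case: latL. Qed.
Lemma latticeB x y : L x -> L y -> L (x - y). Proof. by case: latL => _ + _ _; apply. Qed.
Lemma latticeN x : L x -> L (- x).
Proof. by move=> Lx; rewrite -sub0r; apply: latticeB => //; exact: lattice0. Qed.
Lemma latticeD x y : L x -> L y -> L (x + y).
Proof. by move=> Lx Ly; rewrite -[y]opprK; apply/latticeB/latticeN. Qed.
Lemma latticeMz x (c : int) : L x -> L (x *~ c).
Proof.
move=> Lx; have Ln k : L (x *+ k).
  by elim: k => [|k IHk]; [exact: lattice0 | rewrite mulrS; exact: latticeD].
by case: c => k; rewrite ?NegzE ?mulrNz; [|apply: latticeN]; exact: Ln.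
Qed.
Lemma lattice_sum m (x : 'I_m -> 'rV[R]_n) : (forall i, L (x i)) -> L (\sum_i x i).
Proof.
by move=> Lx; elim/big_ind: _ => //; [exact: lattice0 | exact: latticeD].
Qed.

Lemma lattice_gap : exists2 e : R, 0 < e & forall x, L x -> norm2 x < e -> x = 0.
Proof.
case: latL => L0 _ /(_ 0 L0)[e e0 he] _; exists e => // x Lx xe.
by apply: he; rewrite ?subr0.
Qed.

(** Pigeonhole on a grid of mesh [h] with [n * h < e]: two lattice points in one cell differ by a
    vector shorter than the gap [e], so they coincide. *)
Lemma finite_lattice_box B : finite_set (L `&` box (n:=n) B).
Proof.
have [e e0 gap] := lattice_gap.
have [h hE] : exists h, h = e / n.+1%:R by exists (e / n.+1%:R).
have h0 : 0 < h by rewrite hE divr_gt0.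
pose K := Num.truncn (B / h).
pose f (x : 'rV[R]_n) : {ffun 'I_n -> 'I_K.+1} :=
  [ffun i => inord (Num.truncn (x ord0 i / h))].
have f_inj x y : (L `&` box B) x -> (L `&` box B) y -> f x = f y -> x = y.
  move=> [Lx Bx] [Ly By] /ffunP fxy; apply/eqP; rewrite -subr_eq0; apply/eqP.
  apply: gap; first exact: latticeB.
  have lt_K z i : box B z -> (Num.truncn (z ord0 i / h) < K.+1)%N.
    move=> /(_ i)/andP[z0 zB]; rewrite ltnS; apply: le_truncn.
    by rewrite ler_pM2r ?invr_gt0 // ltW.
  have lt_h i : `|(x - y) ord0 i| <= h.
    have := fxy i; rewrite !ffunE => /(congr1 val); rewrite /= !inordK ?lt_K // => exy.
    have /andP[x0 _] := Bx i; have /andP[y0 _] := By i.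
    have /truncn_itv/andP[] : 0 <= x ord0 i / h by rewrite divr_ge0 // ltW.
    have /truncn_itv/andP[] : 0 <= y ord0 i / h by rewrite divr_ge0 // ltW.
    rewrite exy !ler_pdivlMr // !ltr_pdivrMr // -natr1 !mxE ler_norml.
    by move: (_ %:R) => z; lra.
  apply: le_lt_trans (norm2_le_max (ltW h0) lt_h) _.
  by rewrite hE mulrCA gtr_pMr // ltr_pdivrMr // mul1r ltr_nat.
(* A left inverse of [f] on the box, with default value 0 outside the image. *)
have hg b : exists x, (exists2 y, (L `&` box B) y & f y = b) -> (L `&` box B) x /\ f x = b.
  have [[y Ay fy]|h1] := pselect (exists2 y, (L `&` box B) y & f y = b); first by exists y.
  by exists 0.
have [g hgP] := choice hg.
apply: (@sub_finite_set _ _ (g @` [set: {ffun 'I_n -> 'I_K.+1}])).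
  move=> x Ax; exists (f x) => //.
  have [|Ag fg] := hgP (f x); first by exists x.
  exact: f_inj.
by apply: finite_image; exact: finite_finset.
Qed.

(** Rounding the coefficients of a real combination of lattice vectors moves it by a bounded amount,
    uniformly in the scaling [t]. Hence the supremum in [covering_radius] is taken over a bounded
    set. *)
Lemma lattice_dense : exists2 D : R, 0 <= D &
  forall x, exists2 l, L l & forall i, `|(x - l) ord0 i| <= D.
Proof.
pose P (y : 'rV[R]_n) := exists2 D : R, 0 <= D &
  forall t : R, exists2 l, L l & forall i, `|(t *: y - l) ord0 i| <= D.
have P_comb m (c : 'I_m -> R) (v : 'I_m -> 'rV[R]_n) :
    (forall i, L (v i)) -> P (\sum_(i < m) c i *: v i).
  move=> Lv; elim/big_ind: _ => [|x y [D D0 hx] [D' D'0 hy]|k _].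
  - exists 0 => // t; exists 0; first exact: lattice0.
    by move=> i; rewrite scaler0 subr0 mxE normr0.
  - exists (D + D'); first exact: addr_ge0.
    move=> t; have [l Ll hl] := hx t; have [l' Ll' hl'] := hy t.
    exists (l + l'); first exact: latticeD.
    move=> i; rewrite scalerDr opprD addrACA mxE.
    exact: le_trans (ler_normD _ _) (lerD (hl i) (hl' i)).
  - exists (norm2 (v k)); first exact: sqrtr_ge0.
    move=> t; exists (v k *~ Num.floor (t * c k)); first exact: latticeMz.
    move=> i; rewrite scalerA -scaler_int -scalerBl mxE normrM.
    apply: le_trans (ler_wpM2l (normr_ge0 _) (norm2_ge_coord _ _)) _.
    have /andP[f1 f2] := floor_itv (t * c k); rewrite intrD in f2.
    rewrite -[leRHS]mul1r ler_wpM2r ?sqrtr_ge0 // ler_norml; lra.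
have P_delta j : P (delta_mx ord0 j).
  by case: latL => _ _ _ /(_ (delta_mx ord0 j))[m [c [v [Lv ->]]]]; exact: P_comb.
have hD j : exists D, 0 <= D /\ forall t : R, exists2 l, L l &
    forall i, `|(t *: delta_mx ord0 j - l) ord0 i| <= D.
  by have [D D0 hD] := P_delta j; exists D.
have [D DP] := choice hD.
exists (\sum_j D j) => [|x]; first by apply: sumr_ge0 => j _; case: (DP j).
have hl j : exists l, L l /\ forall i, `|(x ord0 j *: delta_mx ord0 j - l) ord0 i| <= D j.
  by have [_ /(_ (x ord0 j))[l]] := DP j; exists l.
have [l lP] := choice hl.
exists (\sum_j l j); first by apply: lattice_sum => j; case: (lP j).
move=> i; rewrite {1}[x]row_sum_delta -sumrB summxE.
apply: le_trans (ler_norm_sum _ _ _) _; apply: ler_sum => j _.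
by case: (lP j) => _; apply.
Qed.

Lemma inf_dist_le_covering_radius x :
  inf [set norm2 (x - l) | l in L] <= covering_radius L.
Proof.
have [D D0 hD] := lattice_dense.
apply: ub_le_sup; last by exists x.
exists (n%:R * D) => _ [y ->]; have [l Ll hl] := hD y.
apply: le_trans (norm2_le_max D0 hl); apply: ge_inf; last by exists l.
by exists 0 => _ [l' _ <-]; exact: sqrtr_ge0.
Qed.

(** The strict inequality leaves room to use a near-minimal distance without knowing that the
    infimum is attained. *)
Lemma lattice_covering r x : covering_radius L < r ->
  exists2 l, L l & norm2 (x - l) < r.
Proof.
move=> nu_r; have hinf : has_inf [set norm2 (x - l) | l in L].
  split; first by exists (norm2 (x - 0)); exists 0 => //; exact: lattice0.
  by exists 0 => _ [l' _ <-]; exact: sqrtr_ge0.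
have e0 : 0 < r - inf [set norm2 (x - l) | l in L].
  by rewrite subr_gt0; apply: le_lt_trans nu_r; exact: inf_dist_le_covering_radius.
have [_ [l Ll <-] hl] := inf_adherent e0 hinf; exists l => //.
by move: hl; move: (inf _) (norm2 _) => a b; lra.
Qed.

(** The point at distance [t = e / (3 n)] from 0 on a coordinate axis is at distance at least [t]
    from [L]: a closer lattice vector would be shorter than [e], hence 0. *)
Lemma covering_radius_gt0 : (0 < n)%N -> 0 < covering_radius L.
Proof.
move=> n0; have [e e0 gap] := lattice_gap; set i0 := Ordinal n0.
set t := e / (3 * n%:R).
have n0' : 0 < n%:R :> R by rewrite ltr0n.
have t0 : 0 < t by rewrite divr_gt0 // mulr_gt0.
apply: (lt_le_trans t0 (le_trans _ (inf_dist_le_covering_radius (t *: delta_mx ord0 i0)))).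
apply: lb_le_inf.
  by exists (norm2 (t *: delta_mx ord0 i0 - 0)); exists 0 => //; exact: lattice0.
move=> _ [l Ll <-]; rewrite leNgt; apply/negP => lt_t.
have coord i : `|(t *: delta_mx ord0 i0 - l) ord0 i| <= t.
  exact: le_trans (norm2_ge_coord _ _) (ltW lt_t).
have l0 : l = 0.
  apply: gap => //; apply: (@le_lt_trans _ _ (n%:R * (t + t))).
    apply: norm2_le_max; first by rewrite addr_ge0 ?ltW.
    move=> i; have := coord i; rewrite !mxE !ler_norml.
    have hb (b : bool) : 0 <= t * b%:R <= t.
      by rewrite mulr_natr; case: b; rewrite ?mulr1n ?mulr0n ?lexx (ltW t0).
    by move: (hb ((ord0 == ord0 :> 'I_1) && (i == i0))); lra.
  have -> : n%:R * (t + t) = 2 / 3 * e by rewrite /t; field; rewrite gt_eqF.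
  lra.
have := norm2_ge_coord (t *: delta_mx ord0 i0 - l) i0.
rewrite leNgt l0 subr0 !mxE !eqxx mulr1 (gtr0_norm t0) => /negP; apply.
by rewrite l0 subr0 in lt_t.
Qed.

End Lattice.

(** * Linear independence *)

(** For [f] maximizing the absolute minor, Cramer's rule writes each entry of [A] as a minor divided
    by the largest one. *)
Lemma max_minor (R : realFieldType) k n (V : 'M[R]_(k, n)) : row_free V ->
  exists (f : 'I_k -> 'I_n) (A : 'M[R]_(k, n)),
    [/\ forall i j, A i (f j) = (i == j)%:R, forall i j, `|A i j| <= 1 &
        V = colsub f V *m A].
Proof.
move=> freeV; have fullVT : row_full V^T by rewrite /row_full mxrank_tr.
pose minor (f : {ffun 'I_k -> 'I_n}) := \det (colsub f V).
have [f0 minor_f0] : exists f0, minor f0 != 0.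
  exists (fullrankfun fullVT); rewrite -unitfE -unitmxE -unitmx_tr.
  have := fullrowsub_unit fullVT; congr (_ \in unitmx).
  by apply/matrixP => i j; rewrite !mxE.
pose f := [arg max_(f > f0) `|minor f|]%O.
have f_max g : `|minor g| <= `|minor f|.
  by rewrite /f; case: arg_maxP => // h _; apply.
have minor_f : minor f != 0 by rewrite -normr_gt0 (lt_le_trans _ (f_max f0)) ?normr_gt0.
have unitf : colsub f V \in unitmx by rewrite unitmxE unitfE.
exists f, (invmx (colsub f V) *m V); split.
- move=> i j; have := mulVmx unitf => /matrixP/(_ i j).
  by rewrite [in RHS]mxE => <-; rewrite !mxE; apply: eq_bigr => c _; rewrite !mxE.
- move=> i j; pose g := [ffun c => if c == i then j else f c].
  have <- : minor g / minor f = (invmx (colsub f V) *m V) i j.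
    rewrite /invmx unitf -scalemxAl mxE mulrC; congr (_ * _).
    rewrite mxE /minor (expand_det_col _ i); apply: eq_bigr => c _.
    rewrite mulrC; congr (_ * _); last by rewrite mxE ffunE eqxx.
    rewrite mxE /cofactor; congr (_ * \det _); apply/matrixP => x y.
    by rewrite !mxE ffunE eq_sym (negPf (neq_lift _ _)).
  by rewrite normrM normfV ler_pdivrMr ?normr_gt0 // mul1r.
- by rewrite mulmxA mulmxV // mul1mx.
Qed.

Lemma sqr_sum_le (R : realFieldType) k (x : 'I_k -> R) :
  (\sum_i x i) ^+ 2 <= k%:R * \sum_i x i ^+ 2.
Proof.
elim: k x => [|k IHk] x; first by rewrite !big_ord0 expr0n mul0r.
rewrite !big_ord_recl /= -natr1; have := IHk (fun i => x (lift ord0 i)).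
have : 0 <= \sum_i x (lift ord0 i) ^+ 2 by apply: sumr_ge0 => i _; exact: sqr_ge0.
move: (x ord0) (\sum_i x _) (\sum_i _ ^+ 2) => y S T T0.
case: k {IHk x} => [|k]; first by rewrite mul0r; nra.
have k0 : 0 < k.+1%:R :> R by [].
move: (k.+1%:R) k0 => K K0 h; rewrite -subr_ge0 -(pmulr_rge0 _ K0).
have := sqr_ge0 (K * y - S); nra.
Qed.

(** * Lattice points of a box in a proper subspace *)

Section Hyperplane.
Variables (R : realType) (n k : nat) (L : set 'rV[R]_n) (B : R).
Variable V : 'M[R]_(k, n).
Hypotheses (latL : is_full_lattice L) (freeV : row_free V) (kn : (k < n)%N).
Let nu := covering_radius L.
Let S := fset_set (L `&` box (n:=n) B).
Let NH := #|[pred s : S | (val s <= V)%MS]|%:R : R.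
Let sigma : R := Num.sqrt k.+1%:R.

Let memS x : (x \in S) = (x \in L `&` box B).
Proof. by rewrite in_fset_set //; exact: finite_lattice_box. Qed.

(** [packing] is applied with [X] the lattice, [u] the points of the box in the subspace, [v] all
    its points, and [E] the ball of radius [r]. *)
Let count_radius (r : R) : nu < r -> r < B / 2 ->
  NH * (B - 2 * r) ^+ n <=
  #|{: S}|%:R * ((B + 2 * r) ^+ k * (2 * r * sigma) ^+ (n - k)).
Proof.
move=> nu_r rB; have n0 : (0 < n)%N by apply: leq_ltn_trans kn.
have r0 : 0 < r by apply: lt_trans nu_r; exact: covering_radius_gt0.
have sigma0 : 0 < sigma by rewrite sqrtr_gt0.
have [f [A [Af A1 VA]]] := max_minor freeV.
have f_inj : injective f.
  move=> i j fij; have := Af i j; rewrite -fij Af eqxx.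
  by case: eqP => // _ /eqP; rewrite eqr_nat.
pose P : pred 'I_n := [pred j | j \in codom f].
(* On the row space of [V], [T] recovers the coordinates outside [P] from those in [P]; the shear
   therefore flattens the subspace. *)
pose T : 'M[R]_n := \matrix_(i, j)
  if P j then 0 else \sum_a (f a == i)%:R * A a j.
have TE (x : 'rV[R]_n) j : (x *m T) ord0 j =
    if P j then 0 else \sum_a x ord0 (f a) * A a j.
  rewrite mxE; case Pj: (P j).
    by rewrite big1 // => i _; rewrite mxE Pj mulr0.
  under eq_bigr => i _ do rewrite mxE Pj big_distrr /=.
  rewrite exchange_big /=; apply: eq_bigr => a _.
  rewrite (bigD1 (f a)) //= eqxx mul1r big1 ?addr0 // => i /negPf ia.
  by rewrite eq_sym ia mul0r mulr0.
have shearT i j : T i j != 0 -> P i && ~~ P j.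
  rewrite mxE; case: ifP => [_|Pj]; first by rewrite eqxx.
  move=> nz; rewrite andbT; apply: contraNT nz => Pi.
  rewrite big1 // => a _; case: eqP => [fa|_]; last by rewrite mul0r.
  by case/negP: Pi; rewrite -fa; exact: codom_f.
have inH (x : 'rV[R]_n) j : (x <= V)%MS -> ~~ P j -> x ord0 j = (x *m T) ord0 j.
  case/submxP => D -> Pj; rewrite TE (negPf Pj).
  have hx : D *m V = colsub f (D *m V) *m A.
    rewrite {1}VA mulmxA; congr (_ *m _); apply/matrixP => a b.
    by rewrite !mxE; apply: eq_bigr => c _; rewrite mxE.
  by rewrite {1}hx mxE; apply: eq_bigr => a _; rewrite mxE.
(* Cauchy-Schwarz on [k + 1] terms: coordinate [j] of [e] and the [k] coordinates in [P], weighted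
   by entries of [A] of absolute value at most 1. *)
have shear_e (e : 'rV[R]_n) j : norm2 e < r -> ~~ P j ->
    `|(e - e *m T) ord0 j| < r * sigma.
  move=> er Pj.
  have -> : (e - e *m T) ord0 j = e ord0 j - \sum_a e ord0 (f a) * A a j.
    by rewrite mxE; congr (_ + _); rewrite mxE TE (negPf Pj).
  pose x (i : 'I_k.+1) : R :=
    if fintype.unlift ord0 i is Some a then - (e ord0 (f a) * A a j) else e ord0 j.
  have -> : e ord0 j - \sum_a e ord0 (f a) * A a j = \sum_i x i.
    rewrite big_ord_recl /x unlift_none -sumrN; congr (_ + _).
    by apply: eq_bigr => a _; rewrite liftK.
  have x2 : \sum_i x i ^+ 2 <= norm2 e ^+ 2.
    rewrite /norm2 sqr_sqrtr; last by apply: sumr_ge0 => i _; exact: sqr_ge0.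
    rewrite big_ord_recl {1}/x unlift_none (bigD1 j) //= lerD2l.
    apply: (@le_trans _ _ (\sum_a e ord0 (f a) ^+ 2)).
      apply: ler_sum => a _; rewrite /x liftK sqrrN exprMn.
      rewrite -[leRHS]mulr1 ler_wpM2l ?sqr_ge0 //.
      by rewrite -[_ ^+ 2]real_normK ?num_real // exprn_ile1.
    have -> : \sum_a e ord0 (f a) ^+ 2 = \sum_(i <- codom f) e ord0 i ^+ 2.
      by rewrite big_image.
    rewrite big_uniq /=; last by rewrite map_inj_uniq ?enum_uniq.
    rewrite big_mkcond [leRHS]big_mkcond; apply: ler_sum => i _.
    case: ifP => [iP|_]; last by case: ifP => // _; exact: sqr_ge0.
    by case: eqP => // ij; case/negP: Pj; rewrite -ij; exact: iP.
  have e_ge0 : 0 <= norm2 e by rewrite sqrtr_ge0.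
  rewrite -(@ltr_pXn2r _ 2) ?nnegrE ?mulr_ge0 ?(ltW r0) ?(ltW sigma0) // real_normK ?num_real //.
  apply: le_lt_trans (sqr_sum_le _) _; rewrite exprMn mulrC sqr_sqrtr //.
  rewrite ltr_pM2r //; apply: le_lt_trans x2 _.
  by rewrite ltr_pXn2r ?nnegrE // ltW.
pose w j := if P j then B + 2 * r else 2 * r * sigma.
pose a j := if P j then - r else - (r * sigma).
have normD1 (e : 'rV[R]_n) i : norm2 e < r -> - r < e ord0 i < r.
  by move=> er; rewrite -ltr_norml; exact: le_lt_trans (norm2_ge_coord _ _) er.
have SP (s : S) : L (val s) /\ box B (val s).
  by have := valP s; rewrite memS inE => -[].
have := @packing R n {s : S | (val s <= V)%MS} S (fun s => val (val s)) val L
  [set e | norm2 e < r] T P a w (B + r) (B - 2 * r) shearT.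
have -> : \prod_j w j = (B + 2 * r) ^+ k * (2 * r * sigma) ^+ (n - k).
  have cP : #|P| = k by rewrite -[RHS]card_ord -(card_codom f_inj); apply: eq_card.
  rewrite (bigID P) /=; congr (_ * _).
    rewrite (eq_bigr (fun=> B + 2 * r)) => [|i Pi]; last by rewrite /w ifT.
    by rewrite prodr_const cP.
  rewrite (eq_bigr (fun=> 2 * r * sigma)) => [|i Pi]; last by rewrite /w ifF // (negPf Pi).
  by rewrite prodr_const -cP -[X in (X - _)%N](card_ord n) -(cardC P) addKn.
have <- : #|{: {s : S | (val s <= V)%MS}}|%:R = NH by rewrite card_sig.
apply.
- by move=> s s' /val_inj/val_inj.
- move=> j; rewrite /w; case: ifP => _; rewrite ?mulr_gt0 //; lra.
- lra.
- lra.
- move=> g; have [l Ll gl] := lattice_covering latL (r := r) g nu_r.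
  exists l; split; first by rewrite /= -norm2N opprB.
  by move=> [s sV]; apply: latticeD => //; case: (SP s).
(* Aiming at [g - r] centers the cube of side [B - 2 r] in the box, so an error below [r] keeps it
   inside. *)
- move=> g; have [l Ll gl] := lattice_covering latL (r := r) (g - const_mx r) nu_r.
  exists l => y Ly yg.
  have ylB : y - l \in S.
    rewrite memS inE; split; first exact: latticeB.
    move=> i; have := yg i; have := normD1 _ i gl; rewrite !mxE; lra.
  by exists [` ylB]%fset; rewrite /= subrK.
- move=> [s sV] e er j; have [_ /(_ j)] := SP s; have := normD1 e j er.
  rewrite mxE ler_norml /=; lra.
- move=> [s sV] e er j /=; have [_ /(_ j) sj] := SP s.
  rewrite mulmxDl opprD addrACA mxE [(val s - _) _ _]mxE [(- (val s *m T)) _ _]mxE.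
  rewrite /a /w; case: ifP => Pj.
    have -> : (val s *m T) ord0 j = 0 by rewrite TE Pj.
    have -> : (e - e *m T) ord0 j = e ord0 j.
      by rewrite mxE [(- (e *m T)) _ _]mxE TE Pj subr0.
    have := normD1 e j er; lra.
  rewrite -inH ?Pj // subrr add0r; have := shear_e e j er.
  by rewrite Pj ltr_norml => /(_ isT); lra.
Qed.

Lemma card_lattice_subspace_le : 2 * nu < B ->
  NH * (B - 2 * nu) ^+ n <=
  #|{: S}|%:R * ((B + 2 * nu) ^+ k * (2 * nu * sigma) ^+ (n - k)).
Proof.
move=> nuB.
pose p : {poly R} := NH%:P * ((B - 2 * nu)%:P - 2%:P * 'X) ^+ n.
pose q : {poly R} := #|{: S}|%:R%:P * (((B + 2 * nu)%:P + 2%:P * 'X) ^+ k *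
  ((2 * nu * sigma)%:P + (2 * sigma)%:P * 'X) ^+ (n - k)).
have : p.[0] <= q.[0].
  apply: (@horner0_le _ _ _ (B / 2 - nu)); first by lra.
  move=> e /andP[e0 eB]; have := @count_radius (nu + e).
  have -> : p.[e] = NH * (B - 2 * (nu + e)) ^+ n.
    by rewrite /p !hornerE; congr (_ * _ ^+ _); lra.
  have -> : q.[e] = #|{: S}|%:R * ((B + 2 * (nu + e)) ^+ k * (2 * (nu + e) * sigma) ^+ (n - k)).
    have e1 : B + 2 * (nu + e) = B + 2 * nu + 2 * e by ring.
    have e2 : 2 * (nu + e) * sigma = 2 * nu * sigma + 2 * sigma * e by ring.
    by rewrite e1 e2 /q !hornerE.
  by apply; lra.
by rewrite /p /q !hornerE ?mulr0 ?subr0 ?addr0 ?mulrA.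
Qed.

End Hyperplane.

(** * Probability that [n] vectors are independent *)

Section Independence.
Variables (R : realType) (n : nat) (L : set 'rV[R]_n) (B : R).
Hypotheses (latL : is_full_lattice L) (n_gt0 : (0 < n)%N).
Let s : R := Num.sqrt n%:R.
Let nu := covering_radius L.
Hypothesis nuB : 8 * s ^+ n * nu <= B.
Let S := fset_set (L `&` box (n:=n) B).
Let Q := 4 * s ^+ n + 1.
Let W := 4 * s ^+ n - 1.
Let c k := Num.sqrt k.+1%:R ^+ (n - k) * Q ^+ k / W ^+ n.

Let sn_ge1 : 1 <= s ^+ n.
Proof. by rewrite exprn_ege1 // -sqrtr1 ler_wsqrtr // ler1n. Qed.

Let nu_gt0 : 0 < nu. Proof. exact: covering_radius_gt0. Qed.

Lemma lattice_box_gt0 : 0 < B.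
Proof. by apply: lt_le_trans nuB; rewrite !mulr_gt0 //; apply: lt_le_trans sn_ge1. Qed.

(** In the extreme case [B = 8 * s ^+ n * nu], the lengths [B + 2 nu] and [B - 2 nu] are [Q] and [W]
    times [2 nu]. For larger [B] the ratios [2 nu / (B - 2 nu)] and [(B + 2 nu) / (B - 2 nu)] only
    decrease. *)
Lemma lattice_subspace_ratio k (V : 'M[R]_(k, n)) : row_free V -> (k < n)%N ->
  #|[pred x : S | (val x <= V)%MS]|%:R <= #|{: S}|%:R * c k :> R.
Proof.
move=> freeV kn.
have x_le : 2 * nu * W <= B - 2 * nu by rewrite /W; move: nuB; lra.
have y_le : (B + 2 * nu) * W <= Q * (B - 2 * nu) by rewrite /W /Q; move: nuB; lra.
have W0 : 0 < W by rewrite /W; move: sn_ge1; lra.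
have Q0 : 0 < Q by rewrite /Q; move: sn_ge1; lra.
have x0 : 0 < 2 * nu * W by rewrite !mulr_gt0.
have d0 : 0 < B - 2 * nu by apply: lt_le_trans x_le.
have := @card_lattice_subspace_le _ _ _ _ B _ latL freeV kn.
rewrite -subr_gt0 => /(_ d0); rewrite -/S -/nu.
set NH := _%:R; set N := #|_|%:R; set sg := Num.sqrt _.
have sg0 : 0 <= sg by rewrite sqrtr_ge0.
have B0 := lattice_box_gt0.
move=> h; rewrite /c mulrA ler_pdivlMr ?exprn_gt0 //.
rewrite -(ler_pM2r (exprn_gt0 n d0)) mulrAC.
apply: (@le_trans _ _ (N * ((B + 2 * nu) ^+ k * (2 * nu * sg) ^+ (n - k)) * W ^+ n)).
  by rewrite ler_wpM2r ?exprn_ge0 // ltW.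
rewrite -mulrA -[leRHS]mulrA ler_wpM2l //.
have -> : (B + 2 * nu) ^+ k * (2 * nu * sg) ^+ (n - k) * W ^+ n =
    sg ^+ (n - k) * (((B + 2 * nu) * W) ^+ k * (2 * nu * W) ^+ (n - k)).
  rewrite -[in W ^+ n](subnKC (ltnW kn)) exprD !exprMn; ring.
have -> : sg ^+ (n - k) * Q ^+ k * (B - 2 * nu) ^+ n =
    sg ^+ (n - k) * ((Q * (B - 2 * nu)) ^+ k * (B - 2 * nu) ^+ (n - k)).
  rewrite -[in LHS](subnKC (ltnW kn)) exprD !exprMn addKn; ring.
have y0 : 0 < (B + 2 * nu) * W by rewrite mulr_gt0 // addr_gt0 // mulr_gt0.
rewrite ler_wpM2l ?exprn_ge0 //; apply: ler_pM.
- by rewrite exprn_ge0 // ltW.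
- by rewrite exprn_ge0 // ltW.
- by rewrite lerXn2r ?nnegrE // ltW // mulr_gt0.
- by rewrite lerXn2r ?nnegrE // ltW.
Qed.

Definition rows_of k (f : {ffun 'I_k -> S}) : 'M[R]_(k, n) :=
  \matrix_(i, j) val (f i) ord0 j.

Let extend k (p : {ffun 'I_k -> S} * S) : {ffun 'I_k.+1 -> S} :=
  [ffun i => if fintype.unlift ord0 i is Some i' then p.1 i' else p.2].

Let extend_inj k : injective (@extend k).
Proof.
move=> [f x] [f' x'] /ffunP e; congr (_, _); last first.
  by have := e ord0; rewrite !ffunE unlift_none.
by apply/ffunP => i; have := e (lift ord0 i); rewrite !ffunE liftK.
Qed.

Let extend_free k f x : row_free (rows_of f) -> ~~ (val x <= rows_of f)%MS ->
  row_free (rows_of (@extend k (f, x))).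
Proof.
move=> free_f x_f.
have colE : rows_of (extend (f, x)) = col_mx (val x) (rows_of f) :> 'M[R]_(1 + k, n).
  apply/matrixP => i j; rewrite !mxE ffunE; case: (unliftP ord0 i) => [i' ->|->].
    have -> : lift ord0 i' = rshift 1 i' by apply/val_inj.
    by rewrite (unsplitK (inr _ i')) mxE.
  have -> : (ord0 : 'I_k.+1) = lshift k (ord0 : 'I_1) by apply/val_inj.
  by rewrite (unsplitK (inl _ ord0)).
suff : @row_free R (1 + k) n (col_mx (val x) (rows_of f)) by rewrite colE.
apply: inj_row_free => v; rewrite -[v]hsubmxK mul_row_col.
rewrite [lsubmx v]mx11_scalar mul_scalar_mx; set a := lsubmx v _ _ => e.
have a0 : a = 0.
  apply: contraNeq x_f => a_neq0; apply/submxP; exists (- (a^-1 *: rsubmx v)).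
  have e2 : a *: val x = - (rsubmx v *m rows_of f) by apply/eqP; rewrite -addr_eq0 e.
  by rewrite mulNmx -scalemxAl -scalerN -e2 scalerA mulVf // scale1r.
have r0 : rsubmx v = 0.
  move: e; rewrite a0 scale0r add0r => /eqP.
  by rewrite (mulmx_free_eq0 _ free_f) => /eqP.
by rewrite a0 r0 raddf0 row_mx0.
Qed.

(** The vectors are added one at a time: given [k] independent ones, the next falls in their span
    with probability at most [c k]. *)
Lemma card_independent k : (k <= n)%N ->
  #|{: S}|%:R ^+ k * \prod_(j < k) (1 - c j) <=
  #|[pred f : {ffun 'I_k -> S} | row_free (rows_of f)]|%:R :> R.
Proof.
have [c01 _ _] := indep_numerics R n_gt0.
elim: k => [|k IHk] kn.
  rewrite expr0 big_ord0 mulr1 ler1n; apply/fintype.card_gt0P.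
  exists (ffun0 (card_ord 0)).
  by rewrite inE /row_free flatmx0 mxrank0.
rewrite big_ord_recr /=.
pose D := [pred p : {ffun 'I_k -> S} * S |
  row_free (rows_of p.1) && ~~ (val p.2 <= rows_of p.1)%MS].
have leD : (#|D| <= #|[pred f : {ffun 'I_k.+1 -> S} | row_free (rows_of f)]|)%N.
  rewrite -(card_imset _ (@extend_inj k)); apply/subset_leq_card/fintype.subsetP.
  move=> _ /imsetP[[f x] + ->]; rewrite inE /= => /andP[h1 h2].
  by rewrite inE; exact: extend_free.
apply: (@le_trans _ _ #|D|%:R); last by rewrite ler_nat.
have -> : #|D| = (\sum_(f : {ffun 'I_k -> S} | row_free (rows_of f))
    #|[pred x : S | ~~ (val x <= rows_of f)%MS]|)%N.
  rewrite -sum1_card; under [RHS]eq_bigr => f _ do rewrite -sum1_card.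
  by rewrite pair_big_dep.
rewrite natr_sum.
apply: (@le_trans _ _ (\sum_(f : {ffun 'I_k -> S} | row_free (rows_of f))
    #|{: S}|%:R * (1 - c k))).
  rewrite sumr_const -[leRHS]mulr_natl exprSr.
  have := ler_wpM2r _ (IHk (ltnW kn)).
  have h : 0 <= #|{: S}|%:R * (1 - c k).
    by rewrite mulr_ge0 // subr_ge0; case/andP: (c01 k kn).
  move=> /(_ _ h); congr (_ <= _); ring.
apply: ler_sum => f free_f.
have := lattice_subspace_ratio free_f kn.
have <- : (#|[pred x : S | (val x <= rows_of f)%MS]| +
    #|[pred x : S | ~~ (val x <= rows_of f)%MS]|)%N = #|{: S}|.
  exact: (cardC [pred x : S | (val x <= rows_of f)%MS]).
rewrite natrD; set a := #|_|%:R; set b := #|_|%:R; lra.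
Qed.

End Independence.

(** * Residues modulo a sublattice of full rank *)

Section ZmodpSubgroups.
Variable N : nat.
Hypothesis N_gt1 : (1 < N)%N.

Lemma intr_Zp_eq0 (z : int) : ((z%:~R : 'Z_N) == 0) = (N %| z)%Z.
Proof.
have natr_eq0 (k : nat) : ((k%:R : 'Z_N) == 0) = (N %| k)%N.
  by rewrite -(inj_eq val_inj) /= val_Zp_nat.
case: z => k; first by rewrite -pmulrn natr_eq0.
by rewrite NegzE rmorphN /= oppr_eq0 -pmulrn natr_eq0 dvdzE abszN.
Qed.

Lemma zsubgroup_order (V : finZmodType) (K : {set V}) (y : V) : zsubgroup K ->
  exists2 d, (0 < d)%N & forall c : int, (y *~ c \in K) = (d %| c)%Z.
Proof.
move=> sK; have exd : exists d, (0 < d)%N && (y *+ d \in K).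
  exists (fingroup.order y); rewrite fingroup.order_gt0 -FinRing.zmodXgE.
  rewrite fingroup.expg_order FinRing.zmod1gE.
  exact: sK.1.
case: (ex_minnP exd) => d /andP[d0 yd] d_min; exists d => // c.
have yq (q : int) : y *~ (q * d) \in K.
  by rewrite mulrC mulrzA -pmulrn; exact: zsubgroupMz.
apply/idP/dvdzP => [yc|[q ->] //]; exists (c %/ d)%Z.
have e : c = (c %/ d)%Z * d + `|(c %% d)%Z|%N.
  by rewrite gez0_abs ?modz_ge0 -?divz_eq // lt0n_neq0.
have yr : y *+ `|(c %% d)%Z|%N \in K.
  have -> : y *+ `|(c %% d)%Z|%N = y *~ c - y *~ ((c %/ d)%Z * d).
    by rewrite {2}e mulrzDr addrC addKr pmulrn.
  exact: sK.2.
have : `|(c %% d)%Z|%N = 0%N.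
  apply/eqP; rewrite -leqn0 leqNgt; apply/negP => r0.
  have := d_min _ (introT andP (conj r0 yr)).
  by rewrite leqNgt ltn_absz_modz.
by move=> r0; rewrite {1}e r0 addr0.
Qed.

(** [H k] consists of the elements of [G] whose coordinates vanish from index [k] on. Coordinate [k]
    embeds [H k.+1] modulo [H k] in the cyclic group ['Z_N]. *)
Lemma cyclic_chain_Zp n (G : {set 'rV['Z_N]_n}) : zsubgroup G -> cyclic_chain n G.
Proof.
move=> sG; pose H k : {set 'rV['Z_N]_n} :=
  finset (fun g => (g \in G) && [forall i : 'I_n, (k <= i)%N ==> (g ord0 i == 0)]).
have HP k g : reflect (g \in G /\ forall i : 'I_n, (k <= i)%N -> g ord0 i = 0) (g \in H k).
  rewrite inE; apply: (iffP andP) => -[Gg /= hg]; split=> //.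
    by move=> i ki; apply/eqP; have /forallP/(_ i)/implyP := hg; apply.
  by apply/forallP => i; apply/implyP => ki; apply/eqP/hg.
have sH k : zsubgroup (H k).
  split; first by apply/HP; split=> [|i _]; [exact: sG.1 | rewrite mxE].
  move=> g g' /HP[Gg hg] /HP[Gg' hg']; apply/HP; split; first exact: sG.2.
  by move=> i ki; rewrite !mxE hg // hg' // subr0.
have HSH k : H k \subset H k.+1.
  apply/fintype.subsetP => g /HP[Gg hg]; apply/HP; split=> // i ki.
  exact/hg/ltnW.
have chainH k : (k <= n)%N -> cyclic_chain k (H k).
  elim: k => [_|k IHk kn].
    have -> : H 0%N = [set 0]%SET; last exact: cyclic_chain0.
    apply/finset.setP => g; rewrite finset.in_set1; apply/HP/eqP => [[_ g0]|->].
      by apply/rowP => i; rewrite mxE g0.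
    by split=> [|i _]; [exact: sG.1 | rewrite mxE].
  pose ik := Ordinal kn; pose nz := [pred g | (g \in H k.+1) && (g ord0 ik != 0)].
  have inHk g : g \in H k.+1 -> g ord0 ik = 0 -> g \in H k.
    move=> /HP[Gg hg] g0; apply/HP; split=> // i; rewrite leq_eqVlt => /orP[/eqP ki|/hg //].
    by rewrite -g0; congr (g _ _); apply/val_inj.
  (* An element with least nonzero coordinate [k] generates the quotient, by division with
     remainder; if all these coordinates vanish, 0 does. *)
  have [y Hy quoy] : exists2 y, y \in H k.+1 & forall g, g \in H k.+1 ->
      exists c : int, g - y *~ c \in H k.
    have [/existsP[g0 nz_g0]|] := boolP [exists g, nz g]; last first.
      rewrite negb_exists => /forallP nnz; exists 0; first exact: (sH k.+1).1.
      move=> g Hg; exists 0; rewrite mulr0z subr0; apply: inHk => //.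
      by have := nnz g; rewrite /= Hg /= negbK => /eqP.
    case: (@arg_minnP _ g0 nz (fun g => val (g ord0 ik)) nz_g0) => y /andP[Hy y0] y_min.
    exists y => // g Hg; set q := (val (g ord0 ik) %/ val (y ord0 ik))%N.
    have Hgq : g - y *~ q%:Z \in H k.+1 by apply: (sH _).2 => //; exact: zsubgroupMz.
    exists q%:Z; apply: inHk => //; apply/eqP/negPn/negP => r0.
    have := y_min _ (introT andP (conj Hgq r0)).
    set r := (val (g ord0 ik) %% val (y ord0 ik))%N.
    have -> : (g - y *~ q%:Z) ord0 ik = r%:R.
      have eg : g ord0 ik = y ord0 ik *+ q + r%:R.
        rewrite -[LHS]natr_Zp [X in X%:R](divn_eq _ (val (y ord0 ik))) natrD natrM.
        by rewrite natr_Zp mulr_natl.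
      by rewrite -pmulrn !mxE mulmxnE eg addrC addKr.
    have r_lt : (r < val (y ord0 ik))%N.
      by rewrite ltn_mod lt0n -(inj_eq val_inj) in y0 *.
    have r_ltN : (r < N)%N.
      apply: ltn_trans r_lt _; rewrite -[X in (_ < X)%N](Zp_cast N_gt1); exact: ltn_ord.
    have rE : val (r%:R : 'Z_N) = r by rewrite /= val_Zp_nat // modn_small.
    by rewrite rE leqNgt r_lt.
  have [d d_gt0 yd] := zsubgroup_order y (sH k).
  exact: (cyclic_chainS (IHk (ltnW kn)) (sH k) (sH k.+1) (HSH k) Hy d_gt0 quoy yd).
have -> : G = H n; last exact: chainH.
apply/finset.setP => g; apply/idP/HP => [Gg|[]//]; split=> // i.
by rewrite leqNgt ltn_ord.
Qed.

End ZmodpSubgroups.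

(** * The quotient of the lattice by the span of [n] independent vectors *)

Section Residues.
Variables (R : realType) (n : nat) (L : set 'rV[R]_n) (B : R) (M : 'M[R]_n).
Hypotheses (latL : is_full_lattice L) (n_gt0 : (0 < n)%N).
Hypotheses (freeM : row_free M) (LM : forall i, L (row i M)).
Hypothesis BM : forall i, box (n:=n) B (row i M).

(** [kap] gives coordinates in the basis of rows of [M], and [flo] rounds them down. Since the rows
    have entries between 0 and [B], the number [h] bounds the extent of the fundamental
    parallelepiped. *)
Let h := n%:R * B.
Let kap (x : 'rV[R]_n) : 'rV[R]_n := x *m invmx M.
Let flo (x : 'rV[R]_n) : 'rV[R]_n := (\row_i (Num.floor (kap x ord0 i))%:~R) *m M.

Let uM : M \in unitmx. Proof. by rewrite -row_free_unit. Qed.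
Let kapK x : kap x *m M = x. Proof. exact: mulmxKV. Qed.
Let kap_mul x : kap (x *m M) = x. Proof. exact: mulmxK. Qed.
Let kapB x y : kap (x - y) = kap x - kap y. Proof. exact: mulmxBl. Qed.

Let kapBE x y i : kap (x - y) ord0 i = kap x ord0 i - kap y ord0 i.
Proof. by rewrite kapB; move: (kap x) (kap y) => a b; rewrite !mxE. Qed.
Let kap_zrowE (z : 'I_n -> int) i : kap ((\row_i (z i)%:~R) *m M) ord0 i = (z i)%:~R.
Proof. by rewrite kap_mul mxE. Qed.

Let zrowE (z : 'I_n -> int) :
  (\row_i (z i)%:~R) *m M = \sum_i row i M *~ z i.
Proof. by rewrite mulmx_sum_row; apply: eq_bigr => i _; rewrite mxE scaler_int. Qed.

Let L_zrow (z : 'I_n -> int) : L ((\row_i (z i)%:~R) *m M).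
Proof. by rewrite zrowE; apply: lattice_sum => // i; exact: latticeMz. Qed.

Let L_flo x : L (flo x). Proof. exact: L_zrow. Qed.

Let flo_itv x j : 0 <= (x - flo x) ord0 j < h.
Proof.
have e : (x - flo x) ord0 j =
    \sum_i (kap x ord0 i - (Num.floor (kap x ord0 i))%:~R) * M i j.
  rewrite -{1}[x]kapK /flo -mulmxBl mxE; apply: eq_bigr => i _.
  by rewrite !mxE.
have termP i : 0 <= (kap x ord0 i - (Num.floor (kap x ord0 i))%:~R) * M i j < B.
  have := BM i j; rewrite mxE; have := floor_itv (kap x ord0 i); rewrite intrD.
  by move: (kap x ord0 i) (Num.floor _)%:~R => a b; nra.
rewrite e; apply/andP; split; first by apply: sumr_ge0 => i _; case/andP: (termP i).
have -> : h = \sum_(i < n) B by rewrite sumr_const card_ord -[RHS]mulr_natl.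
apply: ltr_sum; last by move=> i _; case/andP: (termP i).
by apply/hasP; exists (Ordinal n_gt0) => //; rewrite mem_index_enum.
Qed.

(** Pigeonhole: among the reductions of the multiples [x *~ k] two coincide, so some [m <= #|F|]
    sends [x] into the span of [M]. The factorial is divisible by all such [m], and the shift by 2
    makes it exceed 1. *)
Let exponent : exists2 N : nat, (1 < N)%N & forall x, L x -> forall i,
  exists z : int, N%:R * kap x ord0 i = z%:~R.
Proof.
pose F := fset_set (L `&` box (n:=n) h); exists (#|{: F}|.+2)`!.
  exact: leq_trans (fact_geq _).
move=> x Lx i; have memF (k : 'I_#|{: F}|.+1) : x *~ k - flo (x *~ k) \in F.
  rewrite in_fset_set ?inE; last exact: finite_lattice_box.
  split; first by apply: latticeB => //; exact: latticeMz.
  by move=> j; exact: flo_itv.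
pose f k : F := [` memF k]%fset.
have /injectivePn[k [k' kk' /(congr1 val)/= fkk']] : ~~ injectiveb f.
  by apply/negP => /injectiveP /leq_card; rewrite card_ord ltnn.
have kapx (c : 'I_#|{: F}|.+1) : kap (x *~ c) ord0 i = c%:R * kap x ord0 i.
  by rewrite /kap -pmulrn -scaler_nat -scalemxAl mxE.
have := congr1 (fun y => kap y ord0 i) fkk'; rewrite !kapBE !kap_zrowE !kapx.
set z := Num.floor _; set z' := Num.floor _ => e.
have {}e : (k%:R - k'%:R) * kap x ord0 i = (z - z')%:~R.
  by rewrite rmorphB /=; move: e; lra.
have [m [m_gt0 m_le [c mE]]] : exists m : nat, [/\ (0 < m)%N, (m <= #|{: F}|)%N &
    exists c : int, m%:R * kap x ord0 i = c%:~R].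
  have [lt_kk'|lt_k'k|/val_inj] := ltngtP k k'; last by move/eqP: kk'.
  - exists (k' - k)%N; rewrite subn_gt0 lt_kk' (leq_trans (leq_subr _ _)) -1?ltnS ?ltn_ord //.
    split=> //; exists (- (z - z')); rewrite rmorphN /= -e natrB ?(ltnW lt_kk') //; lra.
  - exists (k - k')%N; rewrite subn_gt0 lt_k'k (leq_trans (leq_subr _ _)) -1?ltnS ?ltn_ord //.
    by split=> //; exists (z - z'); rewrite -e natrB ?(ltnW lt_k'k).
have /dvdnP[q ->] : (m %| #|{: F}|.+2`!)%N.
  by apply: dvdn_fact; rewrite m_gt0 (leq_trans m_le) // leqW.
by exists (q%:Z * c); rewrite natrM -mulrA mE rmorphM.
Qed.

Section Box.
Variable B1 : R.
Let S1 := fset_set (L `&` box (n:=n) B1).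
Variable N : nat.
Hypothesis N_gt1 : (1 < N)%N.
Hypothesis kapN : forall x, L x -> forall i, exists z : int, N%:R * kap x ord0 i = z%:~R.
Hypothesis hB1 : h < B1.
Hypothesis h_gt0 : 0 < h.

(** [N * kap x] is integral on [L], so [phi] embeds [L] modulo the span of [M] in a power of ['Z_N];
    the floor merely extracts the integer. *)
Let phi (x : 'rV[R]_n) : 'rV['Z_N]_n := \row_i (Num.floor (N%:R * kap x ord0 i))%:~R.

Let phiE x i : phi x ord0 i = (Num.floor (N%:R * kap x ord0 i))%:~R.
Proof. by rewrite mxE. Qed.

Let phiB x y : L x -> L y -> phi (x - y) = phi x - phi y.
Proof.
move=> Lx Ly; apply/rowP => i.
have [[z ez] [z' ez']] := (kapN Lx i, kapN Ly i).
have e : N%:R * kap (x - y) ord0 i = (z - z')%:~R.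
  by rewrite kapBE mulrBr ez ez' rmorphB.
have subE (a b : 'rV['Z_N]_n) : (a - b) ord0 i = a ord0 i - b ord0 i by rewrite !mxE.
by rewrite subE !phiE e ez ez' !intrKfloor rmorphB.
Qed.

Let phi0P x : L x -> phi x = 0 <-> exists z : 'I_n -> int, x = \sum_i row i M *~ z i.
Proof.
move=> Lx; have N0 : N%:R != 0 :> R by rewrite pnatr_eq0 -lt0n ltnW.
split=> [/rowP phi0|[z ->]].
  have hz i : exists z : int, kap x ord0 i = z%:~R.
    have := phi0 i; rewrite phiE [RHS]mxE; have [z ez] := kapN Lx i.
    rewrite ez intrKfloor => /eqP; rewrite intr_Zp_eq0 // => /dvdzP[q eq].
    exists q; apply: (mulfI N0); rewrite ez eq rmorphM /= mulrC.
    by rewrite -pmulrn.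
  have [z zP] := choice hz; exists z; rewrite -zrowE -{1}[x]kapK.
  by congr (_ *m _); apply/rowP => i; rewrite [RHS]mxE zP.
apply/rowP => i; rewrite -zrowE phiE kap_zrowE [RHS]mxE.
rewrite [N%:R]pmulrn -rmorphM intrKfloor; apply/eqP.
by rewrite intr_Zp_eq0 // dvdz_mulr.
Qed.

Let phi00 : phi 0 = 0.
Proof. by rewrite -(subrr 0) phiB ?subrr //; exact: lattice0. Qed.

Let G : {set 'rV['Z_N]_n} := finset (fun g => `[< exists2 x, L x & phi x = g >]).

Let GP g : g \in G <-> exists2 x, L x & phi x = g.
Proof. by rewrite inE; split=> [/asboolP|?]; last apply/asboolP. Qed.

Let sG : zsubgroup G.
Proof.
split; first by apply/GP; exists 0 => //; exact: lattice0.
move=> g g' /GP[x Lx <-] /GP[x' Lx' <-]; apply/GP; exists (x - x'); first exact: latticeB.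
exact: phiB.
Qed.

Let SP (s : S1) : L (val s) /\ box B1 (val s).
Proof.
have := valP s; rewrite in_fset_set; last exact: finite_lattice_box.
by rewrite inE => -[].
Qed.

Let fib g : pred S1 := [pred s : S1 | phi (val s) == g].

(** [packing] without shear, [X] being the coset of [g]. Vectors in the span of [M] move its points
    within the coset, and a translation by [x0], of class [g - g'], matches it with the coset of
    [g']. *)
Let fib_le g g' : g \in G -> g' \in G ->
  #|fib g|%:R * (B1 - h) ^+ n <= #|fib g'|%:R * (B1 + h) ^+ n :> R.
Proof.
move=> Gg Gg'; have /GP[x0 Lx0 phix0] := sG.2 _ _ Gg Gg'.
have phi_flo x : phi (flo x) = 0.
  by apply/phi0P => //; exists (fun i => Num.floor (kap x ord0 i)); rewrite -zrowE.
have := @packing R n {s : S1 | phi (val s) == g} {s : S1 | phi (val s) == g'}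
  (fun s => val (val s)) (fun s => val (val s)) [set x | L x /\ phi x = g]
  [set e : 'rV[R]_n | forall j, - h < e ord0 j <= 0] 0 (fun=> true)
  (fun=> - h) (fun=> B1 + h) (B1 + h) (B1 - h).
rewrite !card_sig prodr_const card_ord; apply.
- by move=> i j; rewrite mxE eqxx.
- by move=> s s' /val_inj/val_inj.
- by move=> _ /=; move: hB1 h_gt0; lra.
- by move: hB1; lra.
- by move: hB1 h_gt0; lra.
- move=> x; exists (flo x); split=> [j|[s /= /eqP phis]].
    have := flo_itv x j; rewrite !mxE; lra.
  have [Ls _] := SP s; split; first exact: latticeD.
  rewrite -[flo x]opprK -[- flo x]sub0r phiB //; last by apply: latticeB => //; exact: lattice0.
  by rewrite phiB ?phi_flo ?phi00 ?subr0 //; exact: lattice0.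
- move=> x; exists (x0 + flo (x - x0)) => y [Ly phiy] yx.
  have Lt : L (x0 + flo (x - x0)) by apply: latticeD.
  have phit : phi (y - (x0 + flo (x - x0))) = g'.
    by rewrite opprD addrA !phiB ?phi_flo ?subr0 ?phiy ?phix0 ?subKr //; exact: latticeB.
  have yS : y - (x0 + flo (x - x0)) \in S1.
    rewrite in_fset_set ?inE; last exact: finite_lattice_box.
    split; first exact: latticeB.
    move=> j; have := yx j; have := flo_itv (x - x0) j; rewrite !mxE; lra.
  have phiS : phi (val ([` yS]%fset : S1)) == g' by rewrite /= phit.
  by exists (exist _ ([` yS]%fset : S1) phiS); rewrite /= subrK.
- move=> [s ps] e he j; have [_ /(_ j)] := SP s; have := he j.
  rewrite mxE ler_norml /=; lra.
- move=> [s ps] e he j; have [_ /(_ j)] := SP s; have := he j.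
  rewrite mulmx0 subr0 /= mxE; lra.
Qed.

Let phiD x y : L x -> L y -> phi (x + y) = phi x + phi y.
Proof.
move=> Lx Ly; have L0 := lattice0 latL; have LNy := latticeN latL Ly.
by rewrite -[y in LHS]opprK phiB // -[- y]sub0r phiB // phi00 sub0r opprK.
Qed.

Let phiMz x (c : int) : L x -> phi (x *~ c) = phi x *~ c.
Proof.
move=> Lx; have L0 := lattice0 latL.
have phin k : phi (x *+ k) = phi x *+ k.
  elim: k => [|k IHk]; first by rewrite !mulr0n.
  by rewrite !mulrS phiD ?IHk // pmulrn; exact: latticeMz.
case: c => k; first by rewrite -!pmulrn.
rewrite NegzE !mulrNz -[- (x *~ _)]sub0r phiB //; last exact: latticeMz.
by rewrite phi00 sub0r -!pmulrn phin.
Qed.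

Let phi_sum m (x : 'I_m -> 'rV[R]_n) : (forall i, L (x i)) ->
  phi (\sum_i x i) = \sum_i phi (x i).
Proof.
move=> Lx; have L0 := lattice0 latL.
suff : L (\sum_i x i) /\ phi (\sum_i x i) = \sum_i phi (x i) by case.
elim/big_rec2: _ => [|i y z _ [Lz e]]; first by rewrite phi00.
by rewrite phiD // e; split=> //; exact: latticeD.
Qed.

(** Subtracting a combination of [w] with the same residue leaves a vector in the span of [M]. *)
Let gen_groupE (w : 'I_n.+1 -> 'rV[R]_n) : (forall j, L (w j)) ->
  (forall x, x \in G -> zspan (fun j => phi (w j)) x) ->
  gen_group (fun i => row i M) w = L.
Proof.
move=> Lw genG; apply/seteqP; split=> x.
  move=> [a [b ->]]; apply: latticeD => //; apply: lattice_sum => // i; exact: latticeMz.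
move=> Lx; have [b phix] : zspan (fun j => phi (w j)) (phi x).
  by apply: genG; apply/GP; exists x.
have Lb : L (\sum_j w j *~ b j) by apply: lattice_sum => // j; exact: latticeMz.
have /phi0P[|a xE] : phi (x - \sum_j w j *~ b j) = 0.
- rewrite phiB // phi_sum; last by move=> j; exact: latticeMz.
  by rewrite phix; under [X in _ - X]eq_bigr => j _ do rewrite phiMz //; rewrite subrr.
- exact: latticeB.
by exists a, b; rewrite -xE subrK.
Qed.

Let rho := ((B1 - h) / (B1 + h)) ^+ n.

Let rho_ge0 : 0 <= rho.
Proof. by rewrite exprn_ge0 // divr_ge0 //; move: hB1 h_gt0; lra. Qed.

(** Summing [fib_le] over all cosets shows that none has fewer than [rho] times the average number
    of points. *)
Let fib_ge g : g \in G -> rho * #|{: S1}|%:R <= #|G|%:R * #|fib g|%:R :> R.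
Proof.
move=> Gg.
have -> : #|{: S1}| = (\sum_(g' in G) #|fib g'|)%N.
  rewrite -sum1_card (partition_big (fun s : S1 => phi (val s)) (mem G)) /=.
    by apply: eq_bigr => g' _; rewrite sum1_card.
  by move=> s _; apply/GP; exists (val s) => //; case: (SP s).
have d0 : 0 < B1 + h by move: hB1 h_gt0; lra.
rewrite /rho expr_div_n mulrAC ler_pdivrMr ?exprn_gt0 // natr_sum mulr_sumr.
apply: le_trans (_ : \sum_(g' in G) #|fib g|%:R * (B1 + h) ^+ n <= _).
  by apply: ler_sum => g' Gg'; rewrite mulrC; exact: fib_le.
by rewrite sumr_const -[leLHS]mulr_natl mulrA.
Qed.

(** Tuples are sorted by their residues: each generating tuple of [G] is the residue of at least
    [(rho * #|S1| / #|G|) ^ (n + 1)] tuples of vectors. *)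
Lemma card_generating_residues :
  (\prod_(2 <= i < n.+2) (zeta R i)^-1) * (rho ^+ n.+1 * #|{: S1}|%:R ^+ n.+1) <=
  #|[pred w : {ffun 'I_n.+1 -> S1} |
     `[< gen_group (fun i => row i M) (fun j => val (w j)) = L >]]|%:R :> R.
Proof.
(* Below index 2 the bound is set to 0, because it has to be nonnegative at every index. *)
have hgen := @card_generators_ge _ R (fun i => if (2 <= i)%N then (zeta R i)^-1 else 0)
  n G _ _ (cyclic_chain_Zp N_gt1 sG).
have {hgen} : #|G|%:R ^+ n.+1 * \prod_(2 <= i < n.+2) (zeta R i)^-1 <=
    #|generators n.+1 G|%:R :> R.
  apply: le_trans (hgen _ _).
  - rewrite ler_wpM2l ?exprn_ge0 // le_eqVlt; apply/orP; left; apply/eqP.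
    by apply: eq_big_nat => i /andP[-> _].
  - move=> i; case: ifP => // i2; rewrite invr_ge0.
    exact: le_trans (zeta_ge1 R i2).
  - by move=> m d m2 d0; rewrite m2; exact: card_coprime_tuples_zeta.
set Z := \prod_(_ <= _ < _) _; set Gen := generators _ _ => hgen.
have G_gt0 : 0 < #|G|%:R :> R.
  by rewrite ltr0n; apply/fintype.card_gt0P; exists 0; exact: sG.1.
pose F (w : {ffun 'I_n.+1 -> S1}) : {ffun 'I_n.+1 -> 'rV['Z_N]_n} :=
  [ffun j => phi (val (w j))].
pose D := [pred w | F w \in Gen].
apply: (@le_trans _ _ #|D|%:R); last first.
  rewrite ler_nat; apply/subset_leq_card/fintype.subsetP => w Dw.
  have {Dw} : F w \in Gen by exact: Dw.
  rewrite inE => /asboolP[_ genG]; apply/asboolP; apply: gen_groupE.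
    by move=> j; case: (SP (w j)).
  by move=> x /genG; apply: zspan_sub => j; rewrite ffunE; exact: mem_zspan.
have -> : #|D| = (\sum_(t in Gen) \sum_(w | D w && (F w == t)) 1)%N.
  by rewrite -sum1_card (partition_big F (mem Gen)).
rewrite natr_sum.
have fiber_ge t : t \in Gen -> (rho * #|{: S1}|%:R) ^+ n.+1 <=
    #|G|%:R ^+ n.+1 * (\sum_(w | D w && (F w == t)) 1)%:R :> R.
  move=> Gent; rewrite sum1_card.
  apply: (@le_trans _ _ (#|G|%:R ^+ n.+1 * #|family (fun j => fib (t j))|%:R)); last first.
    rewrite ler_wpM2l ?exprn_ge0 // ler_nat; apply/subset_leq_card/fintype.subsetP => w.
    move=> /familyP hw; have Fw : F w = t.
      by apply/ffunP => j; rewrite ffunE; apply/eqP; exact: (hw j).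
    by change (D w && (F w == t)); rewrite /D /= Fw eqxx Gent.
  rewrite card_family foldrE big_map big_enum /= natr_prod.
  rewrite -[X in _ <= _ ^+ X * _](card_ord n.+1) -prodr_const.
  rewrite -[X in _ ^+ X <= _](card_ord n.+1) -prodr_const -big_split /=.
  apply: ler_prod => j _; rewrite mulr_ge0 //= fib_ge //.
  by move: Gent; rewrite inE => /asboolP[].
rewrite -exprMn -(ler_pM2l (exprn_gt0 n.+1 G_gt0)) mulrA.
apply: le_trans (ler_wpM2r _ hgen) _; first by rewrite exprn_ge0 // mulr_ge0.
rewrite mulr_sumr mulr_natl -sumr_const; apply: ler_sum => t; exact: fiber_ge.
Qed.

End Box.

Lemma card_generating_ge (B1 : R) : 0 < B -> 8 * n%:R ^+ 2 * n.+1%:R * B <= B1 ->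
  (\prod_(2 <= i < n.+2) (zeta R i)^-1) *
    (3 / 4 * #|{: fset_set (L `&` box (n:=n) B1)}|%:R ^+ n.+1) <=
  #|[pred w : {ffun 'I_n.+1 -> fset_set (L `&` box (n:=n) B1)} |
     `[< gen_group (fun i => row i M) (fun j => val (w j)) = L >]]|%:R :> R.
Proof.
move=> B0 hB1; have [N N1 kapN] := exponent.
have n1 : 1 <= n%:R :> R by rewrite ler1n.
have n2 : 2 <= n.+1%:R :> R by rewrite ler_nat.
have h0 : 0 < h by rewrite mulr_gt0 // ltr0n.
have hB : 8 * (n%:R * n.+1%:R) * h <= B1.
  by apply: le_trans hB1; rewrite /h le_eqVlt; apply/orP; left; apply/eqP; ring.
have nn1 : 2 <= n%:R * n.+1%:R :> R by nra.
have lt_hB1 : h < B1 by nra.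
apply: le_trans (card_generating_residues N1 kapN lt_hB1 h0).
have Z0 : 0 <= \prod_(2 <= i < n.+2) (zeta R i)^-1.
  by rewrite prodfV invr_ge0; apply: le_trans (prod_zeta_ge1 R n).
rewrite ler_wpM2l // ler_wpM2r ?exprn_ge0 // -exprM.
(* Here [rho ^+ n.+1 = (1 - x) ^ (n (n + 1))], and Bernoulli gives at least [1 - n (n + 1) x]. From
   [B1 >= 8 n (n + 1) h] the loss is at most [1/4]. *)
pose x := 2 * h / (B1 + h).
have d0 : 0 < B1 + h by lra.
have x0 : 0 <= x <= 1.
  apply/andP; split; first by apply: divr_ge0; lra.
  by rewrite ler_pdivrMr //; lra.
have -> : (B1 - h) / (B1 + h) = 1 - x by rewrite /x; field; rewrite gt_eqF.
have [] := andP (@prod_subr1_ge R (n * n.+1) (fun=> x) (fun _ _ => x0)).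
rewrite sumr_const prodr_const card_ord => bern _; apply: le_trans bern.
rewrite -[x *+ _]mulr_natl natrM /x mulrA; have : n%:R * n.+1%:R * (2 * h) / (B1 + h) <= 4^-1.
  by rewrite ler_pdivrMr //; lra.
lra.
Qed.

End Residues.

(** * Assembly of the probability bound *)

Lemma gen_prob_ge (R : realType) (n : nat) (L : set 'rV[R]_n) (B B1 : R) :
  (1 <= n)%N -> is_full_lattice L ->
  8 * Num.sqrt (n%:R) ^+ n * covering_radius L <= B ->
  8 * n%:R ^+ 2 * n.+1%:R * B <= B1 ->
  (\prod_(k < n) (1 - Num.sqrt k.+1%:R ^+ (n - k) *
     (4 * Num.sqrt n%:R ^+ n + 1) ^+ k / (4 * Num.sqrt n%:R ^+ n - 1) ^+ n)) *
  (3 / 4 * \prod_(2 <= i < n.+2) (zeta R i)^-1) <= gen_prob L B B1.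
Proof.
move=> n1 latL hB hB1.
have B0 : 0 < B := lattice_box_gt0 latL n1 hB.
have B10 : 0 < B1.
  by apply: lt_le_trans hB1; rewrite !mulr_gt0 ?exprn_gt0 ?ltr0n.
have indep := card_independent latL n1 hB (leqnn n).
move: indep; set c := \prod_(_ < _) _ => indep.
rewrite /gen_prob; set S := fset_set (L `&` box B) in indep *.
set S1 := fset_set (L `&` box B1).
have mem0 C : 0 < C -> 0 \in fset_set (L `&` box (n:=n) C).
  move=> C0; rewrite in_fset_set ?inE; last exact: finite_lattice_box.
  by split; [exact: lattice0 | move=> i; rewrite mxE lexx].
have S_gt0 : 0 < #|{: S}|%:R :> R.
  by rewrite ltr0n; apply/fintype.card_gt0P; exists [` mem0 B B0]%fset.
have S1_gt0 : 0 < #|{: S1}|%:R :> R.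
  by rewrite ltr0n; apply/fintype.card_gt0P; exists [` mem0 B1 B10]%fset.
have -> : #|{: {ffun 'I_n -> S} * {ffun 'I_n.+1 -> S1}}|%:R =
    #|{: S}|%:R ^+ n * #|{: S1}|%:R ^+ n.+1 :> R.
  by rewrite card_prod !card_ffun !card_ord natrM !natrX.
set Z := \prod_(_ <= _ < _) _.
have Z0 : 0 <= Z.
  by rewrite /Z prodfV invr_ge0; apply: le_trans (prod_zeta_ge1 R n).
rewrite ler_pdivlMr ?mulr_gt0 ?exprn_gt0 //.
(* Only pairs whose first block is independent are counted; conditioning on that block reduces to
   [card_generating_ge]. *)
pose D := [pred p : {ffun 'I_n -> S} * {ffun 'I_n.+1 -> S1} | row_free (rows_of p.1) &&
  `[< gen_group (fun i => row i (rows_of p.1)) (fun j => val (p.2 j)) = L >]].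
apply: (@le_trans _ _ #|D|%:R); last first.
  rewrite ler_nat; apply/subset_leq_card/fintype.subsetP => -[f w].
  rewrite inE /= => /andP[_ /asboolP genL]; rewrite inE /=; apply/asboolP.
  rewrite -[RHS]genL; congr gen_group; apply/funext => i.
  by apply/rowP => j; rewrite !mxE.
have -> : #|D| = (\sum_(f : {ffun 'I_n -> S} | row_free (rows_of f))
    #|[pred w : {ffun 'I_n.+1 -> S1} |
      `[< gen_group (fun i => row i (rows_of f)) (fun j => val (w j)) = L >]]|)%N.
  rewrite -sum1_card; under [RHS]eq_bigr => f _ do rewrite -sum1_card.
  by rewrite pair_big_dep.
rewrite natr_sum.
apply: (@le_trans _ _ (\sum_(f : {ffun 'I_n -> S} | row_free (rows_of f))
    Z * (3 / 4 * #|{: S1}|%:R ^+ n.+1))); last first.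
  apply: ler_sum => f free_f.
  have rowP i : L (row i (rows_of f)) /\ box B (row i (rows_of f)).
    have -> : row i (rows_of f) = val (f i) by apply/rowP => j; rewrite !mxE.
    have := valP (f i); rewrite in_fset_set; last exact: finite_lattice_box.
    by rewrite inE => -[].
  by apply: (card_generating_ge latL n1 free_f) B0 hB1 => i; case: (rowP i).
rewrite sumr_const -[leRHS]mulr_natl.
have e0 : 0 <= Z * (3 / 4 * #|{: S1}|%:R ^+ n.+1).
  by rewrite !mulr_ge0 // ?exprn_ge0 // invr_ge0.
apply: le_trans (ler_wpM2r e0 indep).
rewrite le_eqVlt; apply/orP; left; apply/eqP; ring.
Qed.

Unset Implicit Arguments.

Theorem theorem1p1 (R : realType) (n : nat) (L : set 'rV[R]_n) (B B1 : R) :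
  (1 <= n)%N ->
  is_full_lattice L ->
  8 * Num.sqrt (n%:R) ^+ n * covering_radius L <= B ->
  8 * n%:R ^+ 2 * n.+1%:R * B <= B1 ->
  alpha R n <= gen_prob L B B1 /\ 92 / 1000 <= alpha R n.
Proof.
move=> n1 latL hB hB1; have [Z4 alpha_ge] := alpha_numerics R n1.
split=> //; apply: le_trans (gen_prob_ge n1 latL hB hB1).
have [c01 cd d_ge] := indep_numerics R n1; rewrite /alpha mulrC.
(* As the zeta product [Z] is at most 1, [Z - 1/4 <= 3/4 * Z], which connects [alpha] with the bound
   of [gen_prob_ge]. *)
have Z1 : \prod_(2 <= i < n.+2) (zeta R i)^-1 <= 1.
  rewrite prodfV invf_le1; first exact: prod_zeta_ge1.
  by apply: lt_le_trans (prod_zeta_ge1 R n).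
apply: ler_pM => //; [by apply: le_trans d_ge; lra | by rewrite subr_ge0 | lra].
Qed.
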